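(* The following implications are false in general for computable topological spaces (i.e. for each of them there is a computable topological space satisfying the left-hand side but not the right-hand side): (1) $\mathrm{CT}_2+\mathrm D\Rightarrow\mathrm{SCT}_2$; (2) $\mathrm{CT}_0+\mathrm{CT}_4\Rightarrow \mathrm T_1$; (3) $\mathrm{SCT}_2\Rightarrow \mathrm T_3$; (4) $\mathrm{SCT}_2+\mathrm T_4\Rightarrow\mathrm{WCT}_3$; (5) $\mathrm{CTy}+\mathrm D\Rightarrow\mathrm{SCT}_3$.
   Context: Basics. $\Sigma$ is a finite alphabet with $0,1\in\Sigma$; $\Sigma^*$ is the set of finite words and $\Sigma^\omega$ the set of infinite sequences over $\Sigma$. $f:\subseteq A\to B$ denotes a partial function. For $Y_0,\ldots,Y_n\in\{\Sigma^*,\Sigma^\omega\}$ a partial function $f:\subseteq Y_1\times\ldots\times Y_n\to Y_0$ is computable if it is computed by a Type-2 machine, i.e. a Turing machine with $n$ input tapes, work tapes and a one-way output tape (for output in $\Sigma^*$ it halts with the result on the output tape; for output in $\Sigma^\omega$ it computes forever writing the infinite result). Put $\iota(a_1a_2\ldots a_k):=110a_10a_20\ldots a_k011$ for words. For $u\in\Sigma^*$ and $w\in\Sigma^*\cup\Sigma^\omega$ write $u\ll w$ iff $\iota(u)$ is a subword of $w$. Tupling: $\langle u_1,\ldots,u_n\rangle=\iota(u_1)\ldots\iota(u_n)$, $\langle u,p\rangle=\iota(u)p$, $\langle p,q\rangle=p(0)q(0)p(1)q(1)\ldots$ for words $u,u_i$ and $p,q\in\Sigma^\omega$. A notation (representation)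 of a set $S$ is a surjective partial function $:\subseteq\Sigma^*\to S$ ($:\subseteq\Sigma^\omega\to S$). For $\gamma,\gamma'$ each a notation or representation, $[\gamma,\gamma']\langle y,y'\rangle:=(\gamma(y),\gamma'(y'))$. A multi-function $f:X_1\times\ldots\times X_n\rightrightarrows X_0$ assigns to each argument a possibly empty subset of $X_0$. For notations or representations $\gamma_i:\subseteq Y_i\to X_i$, $f$ is $(\gamma_1,\ldots,\gamma_n,\gamma_0)$-computable if there is a computable $h:\subseteq Y_1\times\ldots\times Y_n\to Y_0$ with $\gamma_0(h(y_1,\ldots,y_n))\in f(\gamma_1(y_1),\ldots,\gamma_n(y_n))$ for all $y_i\in\mathrm{dom}(\gamma_i)$ with $f(\gamma_1(y_1),\ldots,\gamma_n(y_n))\neq\emptyset$. A computable topological space is a tuple $\mathbf X=(X,\tau,\beta,\nu)$ where $\tau$ is a $T_0$-topology on $X$ and $\nu:\subseteq\Sigma^*\to\beta$ is a notation of a base $\beta$ of $\tau$ (possibly $\emptyset\in\beta$) such that $\mathrm{dom}(\nu)$ is recursive and there is an r.e. set $S\subseteq(\mathrm{dom}(\nu))^3$ with $\nu(u)\cap\nu(v)=\bigcup\{\nu(w)\mid(u,v,w)\in S\}$ for all $u,v\in\mathrm{dom}(\nu)$. $\mathcal A$ is the set of closed subsets of $X$. Representations: $\delta:\subseteq\Sigma^\omega\to X$ of points: $\delta(p)=x$ iff $p$ is a list of all $\iota(u)$ (possibly padded with 1s) with $x\in\nu(u)$, so that $u\ll p\iff x\in\nu(u)$; $\theta:\subseteq\Sigma^\omega\to\tau$: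 $p\in\mathrm{dom}(\theta)$ iff all $u\ll p$ are in $\mathrm{dom}(\nu)$, and $\theta(p):=\bigcup\{\nu(u)\mid u\ll p\}$; $\psi^-:\subseteq\Sigma^\omega\to\mathcal A$, $\psi^-(p):=X\setminus\theta(p)$. $\rho:\subseteq\Sigma^\omega\to\mathbb R$ is the standard representation of the reals: $\rho(p)=x$ iff $p$ is a list (in the sense of $\delta$) of all names of open intervals with rational endpoints containing $x$, for a canonical notation of these intervals. $C(X,\mathbb R)$ is the set of continuous functions $X\to\mathbb R$, and $[\delta\to\rho]$ is its canonical representation: $[\delta\to\rho](p)=f$ iff $\rho(\eta_p(q))=f(\delta(q))$ for all $q\in\mathrm{dom}(\delta)$, where $p\mapsto\eta_p$ is the standard (universal, with smn-property) representation of continuous partial functions $\Sigma^\omega\to\Sigma^\omega$. Topological axioms for $(X,\tau)$: $\mathrm D$: discrete. $\mathrm T_1$: for all $x\neq y$ there is $W\in\tau$ with $x\in W$, $y\notin W$. $\mathrm T_3$: for all $x\in X$ and closed $A$ with $x\notin A$ there are disjoint $U,V\in\tau$ with $x\in U$, $A\subseteq V$. $\mathrm T_4$: for all disjoint closed $A,B$ there are disjoint $U,V\in\tau$ with $A\subseteq U$, $B\subseteq V$. Computable axioms for $\mathbf X$ (''+'' means conjunction): - $\mathrm{CT}_0$: $t_0:X\times X\rightrightarrows\beta$ is $(\delta,\delta,\nu)$-computable, where for $x\neq y$, $U\in t_0(x,y)$ iff ($x\in U$ and $y\notin U$) or ($x\notin U$ and $y\in U$), and $t_0(x,x)=\emptyset$.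 - $\mathrm{CT}_2$: $t_2:X\times X\rightrightarrows\beta\times\beta$, $(U,V)\in t_2(x,y)$ iff $x\in U$, $y\in V$, $U\cap V=\emptyset$, is $(\delta,\delta,[\nu,\nu])$-computable. - $\mathrm{SCT}_2$: there is an r.e. set $H\subseteq\Sigma^*\times\Sigma^*$ (of pairs from $\mathrm{dom}(\nu)$) such that for all $x\neq y$ in $X$ there is $(u,v)\in H$ with $x\in\nu(u)$, $y\in\nu(v)$, and $\nu(u)\cap\nu(v)=\emptyset$ for all $(u,v)\in H$. - $\mathrm{WCT}_3$: $t_3^w:X\times\beta\rightrightarrows\beta$, $U\in t_3^w(x,W)$ iff $x\in U\subseteq\overline U\subseteq W$, is $(\delta,\nu,\nu)$-computable. - $\mathrm{SCT}_3$: there are an r.e. set $R\subseteq\mathrm{dom}(\nu)\times\mathrm{dom}(\nu)$ and a computable $r:\subseteq\Sigma^*\times\Sigma^*\to\Sigma^\omega$ such that for all $u,w\in\mathrm{dom}(\nu)$: $\nu(w)=\bigcup\{\nu(u)\mid(u,w)\in R\}$, and $(u,w)\in R\Rightarrow\nu(u)\subseteq\psi^-(r(u,w))\subseteq\nu(w)$. - $\mathrm{CTy}$: $t_{\mathrm{Ty}}:X\times\mathcal A\rightrightarrows C(X,\mathbb R)$, $f\in t_{\mathrm{Ty}}(x,A)$ iff $\mathrm{range}(f)\subseteq[0;1]$, $x\notin A$, $f(x)=0$, $f[A]\subseteq\{1\}$, is $(\delta,\psi^-,[\delta\to\rho])$-computable. - $\mathrm{CT}_4$: $t_4:\mathcal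 A\times\mathcal A\rightrightarrows\tau\times\tau$, $(U,V)\in t_4(A,B)$ iff $U\cap V=\emptyset$, $A\subseteq U$, $B\subseteq V$, is $(\psi^-,\psi^-,[\theta,\theta])$-computable. *)

(* Defs.v *)
From HB Require Import structures.
From mathcomp Require Import all_boot all_order all_algebra.
From mathcomp Require Import all_classical all_reals topology normedtype.
Set Implicit Arguments.
Unset Strict Implicit.
Unset Printing Implicit Defensive.
Import Order.TTheory GRing.Theory Num.Theory.
Import numFieldNormedType.Exports.
Local Open Scope classical_set_scope.

Record alphabet := Alphabet {
  letter :> finType;
  a0 : letter;
  a1 : letter;
  a0_neq_a1 : a0 != a1 }.

Definition word (S : alphabet) := seq S.
Definition sequence (S : alphabet) := nat -> S.

Variant kind := Words | Sequences.

Definition Y (S : alphabet) (k : kind) : Type :=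
  match k with Words => word S | Sequences => sequence S end.

Definition initial (S : alphabet) (w : word S) (p : sequence S) : Prop :=
  w = mkseq p (size w).

(** * Type-2 machines *)

Variant move := MLeft | MStay | MRight.

Definition move_nat (m : move) (i : nat) : nat :=
  match m with MLeft => i.-1 | MStay => i | MRight => i.+1 end.

Definition move_int (m : move) (z : int) : int :=
  match m with MLeft => z - 1 | MStay => z | MRight => z + 1 end%R.

(* [n] read-only input tapes with cells indexed by [nat], where [None] is the
   blank; [tapes] two-way infinite work tapes; one output tape to which letters
   can only be appended. In the value of [trans], the components are the next
   state, the moves of the input heads, the symbols written on the work tapes
   with the moves of their heads, and the letter output, if any; the value
   [None] means that the machine halts. *)
Record machine (S : alphabet) (n : nat) := Machine {
  state : finType;
  start : state;
  symbol : finType;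
  blank : symbol;
  tapes : nat;
  trans : state -> {ffun 'I_n -> option S} -> {ffun 'I_tapes -> symbol} ->
    option (state * ('I_n -> move) * ('I_tapes -> symbol * move) * option S) }.

Section Run.
Context {S : alphabet} {n : nat} (M : machine S n).

Record config := Config {
  cur : state M;
  ipos : 'I_n -> nat;
  wtape : 'I_(tapes M) -> int -> symbol M;
  wpos : 'I_(tapes M) -> int;
  out : seq S }.

Definition init : config :=
  Config (start M) (fun=> 0) (fun _ _ => blank M) (fun=> 0%R) [::].

Definition step (x : 'I_n -> nat -> option S) (c : config) : option config :=
  match trans (cur c) [ffun i => x i (ipos c i)]
                      [ffun j => wtape c j (wpos c j)] with
  | None => None
  | Some (s, im, wm, o) =>
      Some (Config s
        (fun i => move_nat (im i) (ipos c i))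
        (fun j z => if z == wpos c j then (wm j).1 else wtape c j z)
        (fun j => move_int (wm j).2 (wpos c j))
        (out c ++ seq_of_opt o))
  end.

Definition run (x : 'I_n -> nat -> option S) (t : nat) : option config :=
  iter t (obind (step x)) (Some init).

(* The machine halts with result [w], or it writes the sequence [p] forever. *)
Definition result (x : 'I_n -> nat -> option S) (k : kind) : Y S k -> Prop :=
  match k with
  | Words => fun w : word S =>
      exists t c, [/\ run x t = Some c, step x c = None & out c = w]
  | Sequences => fun p : sequence S =>
      (forall t c, run x t = Some c -> initial (out c) p) /\
      (forall m, exists t c, run x t = Some c /\ m <= size (out c))
  end.

End Run.

Definition tape_of (S : alphabet) (k : kind) : Y S k -> nat -> option S :=
  match k with
  | Words => fun (w : word S) i => onth w i
  | Sequences => fun (p : sequence S) i => Some (p i)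
  end.

Section Computability.
Context {S : alphabet}.

(* The inputs of [result] are the contents of the input tapes. *)
Definition computable1 (k k0 : kind) (f : Y S k -> option (Y S k0)) : Prop :=
  exists M : machine S 1, forall y z,
    f y = Some z <-> result M (tnth [tuple tape_of y]) z.

Definition computable2 (k1 k2 k0 : kind)
    (f : Y S k1 -> Y S k2 -> option (Y S k0)) : Prop :=
  exists M : machine S 2, forall y1 y2 z,
    f y1 y2 = Some z <-> result M (tnth [tuple tape_of y1; tape_of y2]) z.

(* Domains of computable partial functions from tuples of words to words. *)
Definition re (n : nat) (A : set (n.-tuple (word S))) : Prop :=
  exists M : machine S n, forall t : n.-tuple (word S),
    A t <-> exists w : Y S Words,
      result M (fun i => tape_of (tnth t i : Y S Words)) w.

Definition recursive (A : set (word S)) : Prop :=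
  @computable1 Words Words
    (fun u => Some (if `[< A u >] then [:: a1 S] else [:: a0 S])).

End Computability.

(** * Coding *)

Section Coding.
Context {S : alphabet}.
Local Notation zero := (a0 S).
Local Notation one := (a1 S).

(* Written iota in the literature, a name used in [seq]:
   a_1 ... a_k is sent to 110 a_1 0 a_2 0 ... a_k 011. *)
Definition enclose (u : word S) : word S :=
  [:: one; one] ++ flatten [seq [:: zero; a] | a <- u] ++ [:: zero; one; one].

Definition occurs (u : word S) (p : sequence S) : Prop :=
  exists i, initial (enclose u) (fun j => p (i + j)).

Definition pairing (k : kind) : Y S k -> Y S k -> Y S k :=
  match k with
  | Words => fun u v : word S => enclose u ++ enclose v
  | Sequences => fun (p q : sequence S) i => if odd i then q i./2 else p i./2
  end.

(* [p] is the concatenation of blocks, each of which is either the padding 1 or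
   [enclose u] for some [u] in [A], and every [u] in [A] appears. *)
Definition lists (p : sequence S) (A : set (word S)) : Prop :=
  exists b : nat -> word S,
    [/\ forall i, b i = [:: one] \/ exists2 u, A u & b i = enclose u,
        forall u, A u -> exists i, b i = enclose u &
        forall n, initial (flatten (mkseq b n)) p].

End Coding.

(** * Naming systems *)

(* Notations and representations, given by the graphs of the naming maps. *)
Definition naming (S : alphabet) (k : kind) (X : Type) := Y S k -> X -> Prop.

Definition pair_naming (S : alphabet) (k : kind) (X X' : Type)
    (g : naming S k X) (g' : naming S k X') : naming S k (X * X') :=
  fun y x => exists y1 y2, [/\ y = pairing y1 y2, g y1 x.1 & g' y2 x.2].

Definition multi_computable (S : alphabet) (k1 k2 k0 : kind) (X1 X2 X0 : Type)
    (g1 : naming S k1 X1) (g2 : naming S k2 X2) (g0 : naming S k0 X0)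
    (f : X1 -> X2 -> set X0) : Prop :=
  exists h : Y S k1 -> Y S k2 -> option (Y S k0), computable2 h /\
    forall y1 y2 x1 x2, g1 y1 x1 -> g2 y2 x2 -> f x1 x2 !=set0 ->
      exists2 y0, h y1 y2 = Some y0 & exists2 x0, g0 y0 x0 & f x1 x2 x0.

(* A word [s 1^a 0 1^b] names the rational [(-1)^s * a / (b + 1)]. *)
Definition rat_name (S : alphabet) : naming S Words rat := fun u q =>
  exists (s : bool) (a b : nat),
    u = (if s then a1 S else a0 S) :: nseq a (a1 S) ++ a0 S :: nseq b (a1 S) /\
    q = ((-1) ^+ s * (a%:R / b.+1%:R))%R.

Definition interval_name (S : alphabet) (R : realType) :
    naming S Words (set R) := fun w J =>
  exists u v : word S, exists q r : rat,
    [/\ w = pairing (u : Y S Words) v, rat_name u q, rat_name v r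
      & J = `]ratr q, ratr r[].

Definition rho (S : alphabet) (R : realType) : naming S Sequences R := fun p x =>
  lists p [set w | exists2 J : set R, interval_name w J & J x].

(* [eta p q r] means that the continuous partial function with name [p] maps [q]
   to [r]. The name [p] lists pairs [(u, v)] of words, each of which says that
   the value begins with [v] if the argument begins with [u]; [q] is in the
   domain iff the words [v] that apply to [q] are consistent and unbounded in
   length. The functions obtained are exactly the continuous functions with a
   G_delta domain, and the utm- and smn-theorems hold. *)
Definition eta (S : alphabet) (p q r : sequence S) : Prop :=
  let applies v := exists n, occurs (pairing (mkseq q n : Y S Words) v) p in
  (forall v, applies v -> initial v r) /\
  (forall m, exists2 v, applies v & m <= size v).

(** * Computable topological spaces *)

(* [nu] is a partial map; [base_set nu u] is empty if [u] is not in its domain. *)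
Definition base_set (S : alphabet) (X : Type) (nu : word S -> option (set X))
  (u : word S) : set X := odflt set0 (nu u).

Record ctspace (S : alphabet) := CTSpace {
  points :> topologicalType;
  nu : word S -> option (set points);
  points_T0 : kolmogorov_space points;
  nu_basis : basis [set U | exists u, nu u = Some U];
  nu_recursive : recursive [set u | nu u];
  nu_inter : exists I : set (3.-tuple (word S)),
    [/\ re I,
        forall u v w, I [tuple u; v; w] -> [/\ nu u, nu v & nu w] &
        forall u v, nu u -> nu v -> base_set nu u `&` base_set nu v =
          \bigcup_(w in [set w | I [tuple u; v; w]]) base_set nu w] }.

Section Separation.
Context {S : alphabet} (X : ctspace S).

Local Notation base := [set U | exists u, nu X u = Some U].
Local Notation B u := (base_set (@nu S X) u).

Definition nu_name : naming S Words (set X) := fun u U => nu X u = Some U.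

Definition delta : naming S Sequences X := fun p x => lists p [set u | B u x].

Definition theta : naming S Sequences (set X) := fun p U =>
  (forall u, occurs u p -> nu X u) /\
  U = \bigcup_(u in [set u | occurs u p]) B u.

Definition psi_minus : naming S Sequences (set X) := fun p A => theta p (~` A).

Definition delta_to_rho (R : realType) : naming S Sequences (X -> R) := fun p f =>
  continuous f /\
  forall q x, delta q x -> exists2 r, eta p q r & rho r (f x).

Definition D : Prop := forall A : set X, open A.

Definition T1 : Prop := accessible_space X.

Definition T3 : Prop := forall (x : X) (A : set X), closed A -> ~ A x ->
  exists U V : set X, [/\ open U, open V, U `&` V = set0, U x & A `<=` V].

Definition T4 : Prop := forall A A' : set X,
  closed A -> closed A' -> A `&` A' = set0 ->
  exists U V : set X, [/\ open U, open V, U `&` V = set0, A `<=` U & A' `<=` V].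

Definition t0 (x y : X) : set (set X) :=
  [set U | base U /\ ((U x /\ ~ U y) \/ (~ U x /\ U y))].

Definition CT0 : Prop := multi_computable delta delta nu_name t0.

Definition t2 (x y : X) : set (set X * set X) :=
  [set UV | [/\ base UV.1, base UV.2, UV.1 x, UV.2 y & UV.1 `&` UV.2 = set0]].

Definition CT2 : Prop :=
  multi_computable delta delta (pair_naming nu_name nu_name) t2.

Definition SCT2 : Prop := exists H : set (2.-tuple (word S)),
  [/\ re H,
      forall u v, H [tuple u; v] -> nu X u /\ nu X v,
      forall x y : X, x <> y ->
        exists u v, [/\ H [tuple u; v], B u x & B v y] &
      forall u v, H [tuple u; v] -> B u `&` B v = set0].

Definition t3w (x : X) (W : set X) : set (set X) :=
  [set U | [/\ base U, U x, U `<=` closure U & closure U `<=` W]].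

Definition WCT3 : Prop := multi_computable delta nu_name nu_name t3w.

Definition SCT3 : Prop := exists (Q : set (2.-tuple (word S)))
    (r : Y S Words -> Y S Words -> option (Y S Sequences)),
  [/\ re Q, computable2 r,
      forall u w, Q [tuple u; w] -> nu X u /\ nu X w,
      forall w, nu X w -> B w = \bigcup_(u in [set u | Q [tuple u; w]]) B u &
      forall u w, Q [tuple u; w] -> exists p A,
        [/\ r u w = Some p, psi_minus p A, B u `<=` A & A `<=` B w]].

Definition tTy (R : realType) (x : X) (A : set X) : set (X -> R) :=
  [set f : X -> R | [/\ continuous f, range f `<=` `[0%R, 1%R], ~ A x,
                        f x = 0%R & f @` A `<=` [set 1%R]]].

Definition CTy (R : realType) : Prop :=
  multi_computable delta psi_minus (@delta_to_rho R) (@tTy R).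

Definition t4 (A A' : set X) : set (set X * set X) :=
  [set UV | [/\ open UV.1, open UV.2, UV.1 `&` UV.2 = set0, A `<=` UV.1
              & A' `<=` UV.2]].

Definition CT4 : Prop :=
  multi_computable psi_minus psi_minus (pair_naming theta theta) t4.

End Separation.

(* Main.v *)
From HB Require Import structures.
Require Import Defs.
From mathcomp Require Import all_boot all_order all_algebra.
From mathcomp Require Import all_classical all_reals topology normedtype.

(** Five spaces are built, one for each implication. The idea common to them is
    that only the names of a space have to be effective: if basis sets are named
    by finite words and concatenation of words names intersections, the relation
    required of the intersections is recursively enumerable whatever the sets
    are. So the points and the sets may be chosen without any effectiveness, in
    particular by diagonalization. As there are only countably many machines up
    to the results they give ([machine_enumeration]), the [n]-th part of a space
    can be made to defeat the [n]-th machine.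

    - [CT2] and [D] without [SCT2]: over each [n] there is one point with two
      names, or there are two points with one name each. Given names of two
      different points, the sets named at the beginning of the two lists are
      disjoint singletons. But an enumeration as in [SCT2] must contain the pair
      of the two names over [n] if and only if there are two points, and the
      number of points is chosen to the contrary ([twins_notSCT2]).
    - [CT0] and [CT4] without [T1]: the Sierpinski space. Of two disjoint closed
      sets one is empty, and a search in the two names shows which.
    - [SCT2] without [T3]: a sequence of limits of sequences converges to a hub,
      and there are clopen sets enough for [SCT2]; in addition the set of all
      points but the limits is made open. Then the limits form a closed set, and
      every neighbourhood of the hub meets every neighbourhood of almost all of
      them ([comb_notT3]).
    - [SCT2] and [T4] without [WCT3]: this time the sets that omit a single limit
      are made open, which leaves the topology that of an ultrametric space,
      hence [T4]. How small a neighbourhood of the hub must be for its closure to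
      omit the [n]-th limit depends on a number [K n] that does not show in the
      names of the hub. So the answer of the [n]-th machine to a fixed name
      of the hub is known before [K n] is chosen ([comb_notWCT3]).
    - [CTy] and [D] without [SCT3]: the points are the numbers, and [n] has a
      second name, which denotes either the singleton of [n] or the empty set.
      A name of a point reveals the point, so the function that is zero there and
      one elsewhere can be computed. But whoever puts a closed set between two
      basis sets as in [SCT3] would have to know whether the second name of [n]
      denotes the empty set ([echoes_notSCT3]).

    The positive parts need actual machines. They are obtained from flowcharts
    with counters, a counter being the position of a head on a work tape
    ([result_exec], [result_forever]). Besides comparing and searching words,
    these programs read the beginning of a name of a point ([exec_read_number])
    and print words given by nested loops ([exec_print]), which is how a name of
    a real function is produced ([result_graph]). *)

Set Implicit Arguments.
Unset Strict Implicit.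
Unset Printing Implicit Defensive.
Import Order.TTheory GRing.Theory Num.Theory.
Import numFieldNormedType.Exports.
Local Open Scope classical_set_scope.

(** * Counter programs *)

Section Programs.
Context {S : alphabet} {n k : nat}.

Record store := Store { hd : 'I_n -> nat; ct : 'I_k -> nat }.

Definition store0 : store := Store (fun=> 0) (fun=> 0).

Variant op := Nop | Inc of 'I_k | Dec of 'I_k | Move of 'I_n & move | Out of S.

Definition setc (s : store) (j : 'I_k) (v : nat) : store :=
  Store (hd s) (fun l => if l == j then v else ct s l).

Definition seth (s : store) (i : 'I_n) (v : nat) : store :=
  Store (fun l => if l == i then v else hd s l) (ct s).

Definition do_op (o : op) (s : store) : store :=
  match o with
  | Nop | Out _ => s
  | Inc j => setc s j (ct s j).+1
  | Dec j => setc s j (ct s j).-1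
  | Move i m => seth s i (move_nat m (hd s i))
  end.

Definition emitted (o : op) : word S := if o is Out a then [:: a] else [::].

Definition test := ('I_n -> option S) -> ('I_k -> bool) -> bool.

(** A flowchart, whose exit is the point [None]. Keeping the points abstract,
    instead of numbering the lines of a program, makes the sequencing operators
    below mere sums of types. *)
Record prog := Prog {
  pt : finType;
  entry : pt;
  act : pt -> ('I_n -> option S) -> ('I_k -> bool) -> op * option pt }.

Definition inputs := 'I_n -> nat -> option S.

Definition look (x : inputs) (s : store) : 'I_n -> option S := fun i => x i (hd s i).
Definition zeros (s : store) : 'I_k -> bool := fun j => ct s j == 0.
Definition holds (x : inputs) (s : store) (t : test) : bool := t (look x s) (zeros s).

Inductive steps (x : inputs) (P : prog) :
    pt P -> store -> word S -> option (pt P) -> store -> Prop :=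
| steps1 q s o r : act q (look x s) (zeros s) = (o, r) ->
    steps x q s (emitted o) r (do_op o s)
| stepsS q q' s o w r s' : act q (look x s) (zeros s) = (o, Some q') ->
    steps x q' (do_op o s) w r s' -> steps x q s (emitted o ++ w) r s'.

Definition exec (x : inputs) (P : prog) (s : store) (w : word S) (s' : store) :=
  steps x (entry P) s w None s'.

Lemma steps_trans x P (q q' : pt P) s w s' w' r s'' :
  steps x q s w (Some q') s' -> steps x q' s' w' r s'' -> steps x q s (w ++ w') r s''.
Proof.
move Er: (Some q') => r' H; elim: H Er => {q s w r' s'}.
  by move=> q s o r' H E H'; apply: stepsS H' => //; rewrite H E.
move=> q q1 s o w r' s' H _ IH E H'; rewrite -catA.
by apply: stepsS H _; apply: IH.
Qed.

(** The one lemma behind all the operators: the points of a part of a flowchart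
    do in the whole what they do in the part, except for the exit. *)
Lemma steps_embed x (P Q : prog) (f : pt P -> pt Q) (g : option (pt P) -> option (pt Q)) :
  (forall q, g (Some q) = Some (f q)) ->
  (forall q a b, act (f q) a b = ((act q a b).1, g (act q a b).2)) ->
  forall q s w r s', steps x q s w r s' -> steps x (f q) s w (g r) s'.
Proof.
move=> gS fg q s w r s'; elim=> {q s w r s'}.
  by move=> q s o r H; apply: steps1; rewrite fg H.
move=> q q' s o w r s' H _; apply: stepsS.
by rewrite fg H /= gS.
Qed.

Definition basic (o : op) : prog :=
  @Prog unit tt (fun _ _ _ => (o, None)).

Definition seqp (P Q : prog) : prog :=
  @Prog (pt P + pt Q)%type (inl (entry P)) (fun q a b =>
    match q with
    | inl p => ((act p a b).1, Some (if (act p a b).2 is Some p' then inl p'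
                                     else inr (entry Q)))
    | inr p => ((act p a b).1, omap inr (act p a b).2)
    end).

Definition cond (t : test) (P Q : prog) : prog :=
  @Prog (option (pt P + pt Q)) None (fun q a b =>
    match q with
    | None => (Nop, Some (Some (if t a b then inl (entry P) else inr (entry Q))))
    | Some (inl p) => ((act p a b).1, omap (Some \o inl) (act p a b).2)
    | Some (inr p) => ((act p a b).1, omap (Some \o inr) (act p a b).2)
    end).

Definition while (t : test) (P : prog) : prog :=
  @Prog (option (pt P)) None (fun q a b =>
    match q with
    | None => (Nop, if t a b then Some (Some (entry P)) else None)
    | Some p => ((act p a b).1, Some (act p a b).2)
    end).

Definition forever (P : prog) : prog :=
  @Prog (pt P) (entry P) (fun q a b =>
    ((act q a b).1, Some (odflt (entry P) (act q a b).2))).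

Lemma exec_basic x o s : exec x (basic o) s (emitted o) (do_op o s).
Proof. exact: steps1. Qed.

Lemma steps_seql x P Q s w s' : exec x P s w s' ->
  steps x (entry (seqp P Q)) s w (Some (inr (entry Q))) s'.
Proof.
move=> H; pose g (r : option (pt P)) : option (pt (seqp P Q)) :=
  Some (if r is Some p' then inl p' else inr (entry Q)).
exact: (steps_embed (Q := seqp P Q) (f := inl) (g := g) _ _ H).
Qed.

Lemma steps_seqr x P Q q s w r s' : steps x q s w r s' ->
  @steps x (seqp P Q) (inr q) s w (omap inr r) s'.
Proof. exact: (@steps_embed x Q (seqp P Q) inr (omap inr)). Qed.

Lemma exec_seq x P Q s w s' w' s'' : exec x P s w s' -> exec x Q s' w' s'' ->
  exec x (seqp P Q) s (w ++ w') s''.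
Proof. by move=> HP /steps_seqr HQ; apply: steps_trans (steps_seql Q HP) (HQ P). Qed.

Lemma exec_cond x t P Q s w s' :
  exec x (if holds x s t then P else Q) s w s' -> exec x (cond t P Q) s w s'.
Proof.
move=> H; have st: act (entry (cond t P Q)) (look x s) (zeros s) =
  (Nop, Some (Some (if holds x s t then inl (entry P) else inr (entry Q)))) by [].
case: (holds x s t) H st => H st; apply: (stepsS st).
  exact: (@steps_embed x P (cond t P Q) (Some \o inl) (omap (Some \o inl)) _ _ _ _ _ _ _ H).
exact: (@steps_embed x Q (cond t P Q) (Some \o inr) (omap (Some \o inr)) _ _ _ _ _ _ _ H).
Qed.

Lemma exec_while0 x t P s : holds x s t = false -> exec x (while t P) s [::] s.
Proof. by move=> H; apply: (@steps1 x (while t P) None s Nop); rewrite /= -/(holds x s t) H. Qed.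

Lemma exec_whileS x t P s w s' w' s'' : holds x s t -> exec x P s w s' ->
  exec x (while t P) s' w' s'' -> exec x (while t P) s (w ++ w') s''.
Proof.
move=> H HP HW; apply: (@stepsS x (while t P) None (Some (entry P)) s Nop).
  by rewrite /= -/(holds x s t) H.
apply: steps_trans HW.
exact: (@steps_embed x P (while t P) Some Some _ _ _ _ _ _ _ HP).
Qed.

Lemma steps_forever x P s w s' : exec x P s w s' ->
  steps x (entry (forever P)) s w (Some (entry P)) s'.
Proof.
pose g (r : option (pt P)) : option (pt (forever P)) := Some (odflt (entry P) r).
exact: (@steps_embed x P (forever P) id g).
Qed.

(** * Programs run on machines *)

(** A counter is the position of the head of a work tape; the cell at which the
    head starts carries the only mark, so that the zero test is a look at the
    tape. The mark is set in the first step. *)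
Definition head_move (o : op) (i : 'I_n) : move :=
  if o is Move l m then if i == l then m else MStay else MStay.

Definition ctr_move (o : op) (j : 'I_k) (z : bool) : move :=
  match o with
  | Inc l => if j == l then MRight else MStay
  | Dec l => if j == l then if z then MStay else MLeft else MStay
  | _ => MStay
  end.

Definition compile (P : prog) : machine S n :=
  @Machine S n (option (option (pt P))) None bool false k
    (fun q (a : {ffun 'I_n -> option S}) (b : {ffun 'I_k -> bool}) =>
      match q with
      | None => Some (Some (Some (entry P)), fun=> MStay, fun=> (true, MStay), None)
      | Some None => None
      | Some (Some p) => Some (Some (act p a b).2, head_move (act p a b).1,
          fun j => (b j, ctr_move (act p a b).1 j (b j)),
          if (act p a b).1 is Out c then Some c else None)
      end).

Definition rep (P : prog) (r : option (pt P)) (s : store) (w : word S) :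
    config (compile P) :=
  @Config S n (compile P) (Some r) (hd s) (fun _ z => z == 0%R)
    (fun j => Posz (ct s j)) w.

Lemma step_rep x P (q : pt P) s w :
  let: (o, r) := act q (look x s) (zeros s) in
  step x (rep (Some q) s w) = Some (rep r (do_op o s) (w ++ emitted o)).
Proof.
have Ea : [ffun i => x i (hd s i)] = look x s :> ('I_n -> option S).
  by apply/funext => i; rewrite ffunE.
have Eb : [ffun j => Posz (ct s j) == 0%R] = zeros s :> ('I_k -> bool).
  by apply/funext => j; rewrite ffunE.
rewrite /step /= Ea Eb; case: (act _ _ _) => o r /=.
congr (Some _); rewrite /rep; congr (@Config _ _ (compile P) _ _ _ _ _).
- by case: o => //= i m; apply/funext => l; case: eqP => // ->.
- apply/funext => j; apply/funext => z /=; case: eqP => // ->.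
  by rewrite /zeros; case: (ct s j).
- apply/funext => j; rewrite /zeros; case: o => //= l; case: eqP => //= ->.
    by rewrite -addn1 PoszD.
  by case: (ct s l) => [|m] //=; rewrite -addn1 PoszD addrK.
- by case: o.
Qed.

Lemma run_add (M : machine S n) x c t t' : run M x t = Some c ->
  run M x (t + t') = iter t' (obind (step x)) (Some c).
Proof. by rewrite /run addnC iterD => ->. Qed.

Lemma run_steps x P (q : pt P) s w r s' v t :
  steps x q s w r s' -> run (compile P) x t = Some (rep (Some q) s v) ->
  exists t', run (compile P) x (t + t'.+1) = Some (rep r s' (v ++ w)).
Proof.
move=> H; elim: H v t => {q s w r s'}.
  move=> q s o r H v t /run_add E; exists 0; rewrite E.
  by have /= := step_rep x q s v; rewrite H.
move=> q q' s o w r s' H _ IH v t E; rewrite catA.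
have /IH[t' <-] : run (compile P) x t.+1 = Some (rep (Some q') (do_op o s) (v ++ emitted o)).
  by rewrite -addn1 (run_add _ E) /=; have := step_rep x q s v; rewrite H.
by exists t'.+1; rewrite -addSnnS.
Qed.

Lemma run_start x P : run (compile P) x 1 = Some (rep (Some (entry P)) store0 [::]).
Proof.
rewrite /run /= /step /=; congr (Some _); congr (@Config _ _ (compile P) _ _ _ _ _).
by apply/funext => j; apply/funext => z; case: eqP.
Qed.

Lemma result_exec x P w s : exec x P store0 w s -> result (compile P) x (w : Y S Words).
Proof.
move=> /run_steps/(_ (run_start x P))[t E].
by exists (1 + t.+1), (rep None s w).
Qed.

Lemma result_unique (M : machine S n) x kd (y z : Y S kd) :
  result M x y -> result M x z -> y = z.
Proof.
case: kd y z => /= y z.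
  move=> [t [c [E h <-]]] [t' [c' [E' h' <-]]]; congr out.
  wlog le: t c E h t' c' E' h' / t <= t'.
    by case/orP: (leq_total t t') => le W; [|symmetry]; apply: W le.
  move: E'; rewrite -(subnK le) addnC (run_add _ E).
  case: (t' - t) => [|m]; first by case.
  rewrite iterSr /= h.
  suff -> : iter m (obind (step (M := M) x)) None = None by [].
  by elim: m => // m; rewrite iterS => ->.
move=> [y1 y2] [z1 z2]; apply/funext => i.
have [t [c [E lt]]] := y2 i.+1.
have Ey : nth (a0 S) (out c) i = y i by rewrite {1}(y1 _ _ E) nth_mkseq.
by rewrite -Ey {1}(z1 _ _ E) nth_mkseq.
Qed.

Lemma outD (M : machine S n) x t t' c c' : t <= t' ->
  run M x t = Some c -> run M x t' = Some c' -> exists w, out c' = out c ++ w.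
Proof.
move=> le E; rewrite -(subnK le) addnC (run_add _ E).
elim: (t' - t) c' => [|m IH] c' /=; first by case=> <-; exists [::]; rewrite cats0.
case: (iter m _ _) IH => //= c1 /(_ _ erefl)[w Ew].
rewrite /step; case: trans => [[[[q im] wm] o]|//] [<-] /=.
by exists (w ++ seq_of_opt o); rewrite Ew catA.
Qed.

Lemma initial_cat (v w : word S) (p : sequence S) : initial (v ++ w) p -> initial v p.
Proof.
rewrite /initial size_cat /mkseq iotaD map_cat => /eqP.
by rewrite eqseq_cat ?size_map ?size_iota // => /andP[/eqP].
Qed.

(** The output of a machine only grows, so it suffices to look at it at
    arbitrarily late times. *)
Lemma result_sequence (M : machine S n) x (p : sequence S) :
  (forall N, exists t c, [/\ N <= t, run M x t = Some c, initial (out c) p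
                            & N <= size (out c)]) ->
  result M x (p : Y S Sequences).
Proof.
move=> H; split=> [t c E|m]; last by have [t [c [_ E _ le]]] := H m; exists t, c.
have [t' [c' [le E' + _]]] := H t.
by have [w ->] := outD le E E'; apply: initial_cat.
Qed.

Lemma result_forever x (P Q : prog) w (s : nat -> store) (o : nat -> word S) p :
  exec x P store0 w (s 0) -> (forall N, exec x Q (s N) (o N) (s N.+1)) ->
  (forall N, 0 < size (o N)) ->
  (forall N, initial (w ++ flatten (mkseq o N)) p) ->
  result (compile (seqp P (forever Q))) x (p : Y S Sequences).
Proof.
move=> HP HQ o_gt0 Hp; apply: result_sequence => N.
pose P' := seqp P (forever Q).
have [t [le E]] : exists t, N <= t /\ run (compile P') x t =
    Some (rep (Some (inr (entry Q) : pt P')) (s N) (w ++ flatten (mkseq o N))).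
  elim: N => [|N [t [le E]]].
    by have [t E] := run_steps (steps_seql (forever Q) HP) (run_start x P');
       exists (1 + t.+1); rewrite E /= cats0.
  have [t' E'] := run_steps (steps_seqr P (steps_forever (HQ N))) E.
  exists (t + t'.+1); split; first by rewrite addnS ltnS (leq_trans le) ?leq_addr.
  by rewrite E' mkseqS flatten_rcons catA.
exists t, (rep (Some (inr (entry Q) : pt P')) (s N) (w ++ flatten (mkseq o N))).
split=> //=; rewrite size_cat (leq_trans _ (leq_addl _ _)) //.
elim: N {le E} => // N IH; rewrite mkseqS flatten_rcons size_cat -addn1.
by rewrite leq_add.
Qed.

End Programs.

(** * Countability of the machines *)

Section Countable.
Context {S : alphabet} {n : nat}.

Definition to_move (b : option bool) : move :=
  match b with None => MStay | Some b => if b then MRight else MLeft end.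
Definition of_move (m : move) : option bool :=
  match m with MStay => None | MLeft => Some false | MRight => Some true end.

Lemma of_moveK : cancel of_move to_move. Proof. by case. Qed.

Definition table (s q t : nat) := {ffun 'I_s * {ffun 'I_n -> option S} *
  {ffun 'I_t -> 'I_q} -> option ('I_s * {ffun 'I_n -> option bool} *
    {ffun 'I_t -> 'I_q * option bool} * option S)}.

Definition code := {d : nat * nat * nat &
  ('I_d.1.1 * 'I_d.1.2 * table d.1.1 d.1.2 d.2)%type}.

Definition decode (c : code) : machine S n :=
  let: existT d (s, b, tab) := c in
  @Machine S n 'I_d.1.1 s 'I_d.1.2 b d.2 (fun q a w =>
    omap (fun r : 'I_d.1.1 * {ffun 'I_n -> option bool} *
        {ffun 'I_d.2 -> 'I_d.1.2 * option bool} * option S =>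
      (r.1.1.1, fun i => to_move (r.1.1.2 i),
                    fun j => ((r.1.2 j).1, to_move (r.1.2 j).2), r.2))
         (tab (q, a, w))).

Definition encode (M : machine S n) : code :=
  existT _ (#|{: state M}|, #|{: symbol M}|, tapes M)
    (enum_rank (start M), enum_rank (blank M),
     [ffun z : 'I_#|{: state M}| * {ffun 'I_n -> option S} *
             {ffun 'I_(tapes M) -> 'I_#|{: symbol M}|} =>
      omap (fun r => (enum_rank r.1.1.1, [ffun i => of_move (r.1.1.2 i)],
           [ffun j => (enum_rank (r.1.2 j).1, of_move (r.1.2 j).2)], r.2))
        (trans (enum_val z.1.1) z.1.2 [ffun j => enum_val (z.2 j)])]).

Definition image_config (M : machine S n) (c : config M) : config (decode (encode M)) :=
  @Config S n (decode (encode M)) (enum_rank (cur c)) (@ipos S n M c)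
    (fun j z => enum_rank (@wtape S n M c j z)) (@wpos S n M c) (out c).

Lemma step_image M x (c : config M) :
  step x (image_config c) = omap (@image_config M) (step x c).
Proof.
rewrite /step /= !ffunE /= enum_rankK.
have -> : [ffun j => enum_val ([ffun j0 => enum_rank (wtape c j0 (wpos c j0))] j)]
    = [ffun j => wtape c j (wpos c j)].
  by apply/ffunP => j; rewrite !ffunE enum_rankK.
case: trans => //= -[[[q im] wm] o] /=; congr (Some _); rewrite /image_config /=.
congr (@Config _ _ (decode (encode M)) _ _ _ _ _).
- by apply/funext => i; rewrite ffunE of_moveK.
- by apply/funext => j; apply/funext => z; rewrite ffunE; case: eqP.
- by apply/funext => j; rewrite ffunE of_moveK.
Qed.

Lemma run_image M x t : run (decode (encode M)) x t = omap (@image_config M) (run M x t).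
Proof.
elim: t => // t IH; rewrite /run !iterS -/(run _ _ _) IH.
by rewrite -/(run _ _ _); case: (run M x t) => //= c; exact: step_image.
Qed.

(** The translation of configurations commutes with the steps, so nothing
    observable is changed by renaming states and symbols. *)
Lemma result_decode (M : machine S n) x kd (y : Y S kd) :
  result (decode (encode M)) x y <-> result M x y.
Proof.
case: kd y => /= y; split.
- move=> [t [c []]]; rewrite run_image; case E: (run M x t) => [c'|] //= [<-].
  by rewrite step_image; case E': (step x c') => // _ <-; exists t, c'.
- move=> [t [c [E E' <-]]]; exists t, (image_config c).
  by rewrite run_image E step_image E'.
- move=> [H1 H2]; split=> [t c E|m].
    by apply: (H1 t (image_config c)); rewrite run_image E.
  have [t [c []]] := H2 m; rewrite run_image; case E: (run M x t) => [c'|] //= [<-].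
  by exists t, c'.
- move=> [H1 H2]; split=> [t c|m].
    rewrite run_image; case E: (run M x t) => [c'|] //= [<-]; exact: H1 E.
  by have [t [c [E le]]] := H2 m; exists t, (image_config c); rewrite run_image E.
Qed.

(** The state and symbol types of a machine are arbitrary finite types, so the
    machines themselves do not form a countable type; up to the results they
    give, those on ordinals suffice. *)
Lemma machine_enumeration : exists g : nat -> machine S n, forall M, exists e,
  forall x kd (y : Y S kd), result M x y <-> result (g e) x y.
Proof.
pose M0 : machine S n := @Machine S n unit tt unit tt 0 (fun _ _ _ => None).
exists (fun e => if (unpickle e : option code) is Some c then decode c else M0).
by move=> M; exists (pickle (encode M)) => x kd y; rewrite pickleK result_decode.
Qed.

End Countable.

(** * Names *)

Section Names.
Context {S : alphabet}.
Local Notation zero := (a0 S).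
Local Notation one := (a1 S).
Implicit Types (u v w : word S) (p q : sequence S).

Lemma one_neq_zero : one != zero. Proof. by rewrite eq_sym a0_neq_a1. Qed.

Lemma initialP w p : initial w p <-> forall i, i < size w -> nth zero w i = p i.
Proof.
split=> [E i lt|H]; first by rewrite E nth_mkseq.
apply: (@eq_from_nth _ zero) => [|i lt]; first by rewrite size_mkseq.
by rewrite nth_mkseq // H.
Qed.

Lemma initial_catE v w p :
  initial (v ++ w) p <-> initial v p /\ initial w (fun i => p (size v + i)).
Proof.
rewrite !initialP size_cat; split=> [H|[H1 H2] i lt].
  split=> i lt; last by rewrite -H ?ltn_add2l // nth_cat ltnNge leq_addr /= addKn.
  by rewrite -H ?(leq_trans lt) ?leq_addr // nth_cat lt.
rewrite nth_cat; case: ltnP => le; first exact: H1.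
by rewrite H2 ?subnKC // -(ltn_add2l (size v)) subnKC.
Qed.

Lemma initial_cons a w p :
  initial (a :: w) p <-> p 0 = a /\ initial w (fun i => p i.+1).
Proof.
rewrite !initialP; split=> [H|[H1 H2] [|i]] //=; last by rewrite ltnS; apply: H2.
by split=> [|i lt]; rewrite -H.
Qed.

Lemma initial_mkseq p m : initial (mkseq p m) p.
Proof. by rewrite /initial size_mkseq. Qed.

Definition spread w : word S := flatten [seq [:: zero; a] | a <- w].

Lemma spread_cat v w : spread (v ++ w) = spread v ++ spread w.
Proof. by rewrite /spread map_cat flatten_cat. Qed.

Lemma encloseE w : enclose w = [:: one, one & spread w ++ [:: zero; one; one]].
Proof. by []. Qed.

Lemma spread_uniq u v p : initial (spread u ++ [:: zero; one; one]) p ->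
  initial (spread v ++ [:: zero; one; one]) p -> u = v.
Proof.
elim: u v p => [|a u IH] [|b v] p //=; rewrite !initial_cons.
- move=> [_ [_ [p2 _]]] [_ [_ H]]; move: H p2 => /=.
  by case: v => [|c v]; rewrite /= !initial_cons => -[-> _] E;
    move: one_neq_zero; rewrite -E eqxx.
- move=> [_ [_ H]] [_ [_ [p2 _]]]; move: H p2 => /=.
  by case: u {IH} => [|c u]; rewrite /= !initial_cons => -[-> _] E;
    move: one_neq_zero; rewrite -E eqxx.
- by move=> [_ [-> Hu]] [_ [-> Hv]]; rewrite (IH _ _ Hu Hv).
Qed.

Lemma enclose_uniq u v p : initial (enclose u) p -> initial (enclose v) p -> u = v.
Proof.
rewrite !encloseE !initial_cons => -[_ [_ Hu]] [_ [_ Hv]]; exact: spread_uniq Hu Hv.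
Qed.

Lemma enclose_inj : injective (@enclose S).
Proof.
move=> u v E; pose p i := nth zero (enclose u) i.
have H : initial (enclose u) p by apply/initialP.
by apply: (enclose_uniq H); rewrite -E.
Qed.

Lemma pairing_inj u u' v v' :
  pairing (u : Y S Words) v = pairing (u' : Y S Words) v' -> u = u' /\ v = v'.
Proof.
move=> E; have {}E : enclose u ++ enclose v = enclose u' ++ enclose v' := E.
pose p i := nth zero (enclose u ++ enclose v) i.
have H : initial (enclose u ++ enclose v) p by apply/initialP.
have H' : initial (enclose u' ++ enclose v') p by rewrite -E.
have {}E' : u = u'.
  by apply: (@enclose_uniq _ _ p); move: H H'; rewrite !initial_catE => -[? _] [? _].
by move: E; rewrite E' => /eqP; rewrite eqseq_cat // eqxx /= => /eqP/enclose_inj.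
Qed.

(** Every other letter of the body is a zero, and the last zero is followed by
    two letters only: hence a block can be entered at its beginning only. *)
Lemma spread_no110 w a i (t := a :: spread w ++ [:: zero; one; one]) :
  i.+2 < size t -> nth zero t i = one -> nth zero t i.+1 = one ->
  nth zero t i.+2 != zero.
Proof.
rewrite {}/t; elim: w a i => [|b w IH] a [|[|i]] //=.
- by move=> _ _ E; move: one_neq_zero; rewrite -E eqxx.
- by move=> _ E; move: one_neq_zero; rewrite -E eqxx.
- by move=> _ _ E; move: one_neq_zero; rewrite -E eqxx.
- by move=> _ E; move: one_neq_zero; rewrite -E eqxx.
- exact: IH.
Qed.

Lemma flatten_position (B : seq (word S)) m : m < size (flatten B) ->
  exists B1 b B2 d, [/\ B = B1 ++ b :: B2, m = size (flatten B1) + d & d < size b].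
Proof.
elim: B m => //= b B IH m; rewrite size_cat; case: (ltnP m (size b)) => [lt _|le].
  by exists [::], b, B, m.
rewrite -{1}(subnKC le) ltn_add2l => /IH[B1 [b' [B2 [d [-> E lt]]]]].
by exists (b :: B1), b', B2, d; split=> //=; rewrite size_cat -addnA -E subnKC.
Qed.

(** The padding consists of ones, so the first zero of an enclosed word found
    in a list is the third letter of a block, and the blocks form a prefix
    code. *)
Lemma occurs_lists p (A : set (word S)) u : lists p A -> (occurs u p <-> A u).
Proof.
move=> [b [b_ok b_all Hp]]; split; last first.
  move=> /b_all[i E]; exists (size (flatten (mkseq b i))).
  have := Hp i.+1; rewrite mkseqS flatten_rcons E => /initial_catE[_].
  by [].
move=> [i Hi]; have b_gt0 m : 0 < size (b m).
  by case: (b_ok m) => [->|[v _ ->]].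
have [N lt] : exists N, i.+2 < size (flatten (mkseq b N)).
  exists i.+3; elim: (i.+3) => // m IH; rewrite mkseqS flatten_rcons size_cat.
  by rewrite -addn1 leq_add.
have [B1 [c [B2 [d [EB Ei lt_d]]]]] := flatten_position lt.
have Hc : initial c (fun j => p (size (flatten B1) + j)).
  have := Hp N; rewrite EB flatten_cat /= => /initial_catE[_ /initial_catE[]].
  by [].
move: Hi; rewrite encloseE !initial_cons addn0 addn1 => -[p0 [p1 Hi]].
have p2 : p i.+2 = zero.
  by move: Hi; case: (u) => [|? ?]; rewrite /= initial_cons addn2 => -[].
have nz : one <> zero by apply/eqP/one_neq_zero.
have cE : nth zero c d = zero.
  by move/initialP: Hc => ->//; rewrite -Ei.
have /(nth_index [::]) : c \in mkseq b N by rewrite EB mem_cat in_cons eqxx orbT.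
have lt_c : index c (mkseq b N) < N.
  by rewrite -{2}(size_mkseq b N) index_mem EB mem_cat in_cons eqxx orbT.
rewrite nth_mkseq //; move: (index _ _) lt_c => m _ Ec.
have := b_ok m; rewrite Ec => -[Ec1|[v Av Ev]].
  by move: cE lt_d; rewrite Ec1; case: (d) => //= H; case: nz.
suff d2 : d = 2.
  have -> // : u = v.
  apply: (@enclose_uniq _ _ (fun j => p (i + j))).
    by rewrite encloseE !initial_cons addn0 addn1.
  have -> : (fun j => p (i + j)) = (fun j => p (size (flatten B1) + j)).
    by apply/funext => j; congr p; congr addn; move: Ei; rewrite d2 addn2 => -[].
  by rewrite -Ev.
move: cE lt_d Ei Hc; rewrite Ev encloseE.
case: d => [|[|[|d]]] //=.
move=> cE lt_d Ei /initialP Hc; exfalso.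
have Ei1 : i.+1 = size (flatten B1) + d.+2 by apply: succn_inj; rewrite Ei !addnS.
have Ei0 : i = size (flatten B1) + d.+1 by apply: succn_inj; rewrite Ei1 !addnS.
have c1 : nth zero [:: one, one & spread v ++ [:: zero; one; one]] d.+2 = one.
  by rewrite Hc ?p1 -?Ei1 //=; apply: ltnW lt_d.
have c0 : nth zero [:: one, one & spread v ++ [:: zero; one; one]] d.+1 = one.
  by rewrite Hc -?Ei0 //=; do 2 apply: ltnW.
by have := @spread_no110 v one d lt_d c0 c1; rewrite /= cE eqxx.
Qed.

Lemma padding_only (b : nat -> word S) n : (forall i, i < n -> b i = [:: one]) ->
  flatten (mkseq b n) = nseq n one.
Proof.
elim: n => // n IH H; rewrite mkseqS flatten_rcons H // IH => [|i lt].
  by rewrite -addn1 nseqD.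
by rewrite H // ltnW.
Qed.

(** * Building sequences from their beginnings *)

Lemma chain_limit (O : nat -> word S) :
  (forall N, prefix (O N) (O N.+1)) -> (forall N, N <= size (O N)) ->
  exists p, forall N, initial (O N) p.
Proof.
move=> OS Osize; exists (fun i => nth zero (O i.+1) i) => N; apply/initialP => i lt.
have Opre m m' : m <= m' -> prefix (O m) (O m').
  move/subnKC => <-; elim: (m' - m) => [|l IH]; first by rewrite addn0 prefix_refl.
  by rewrite addnS (prefix_trans IH).
have [le|/ltnW le] := leqP N i.+1; have /prefixP[w ->] := Opre _ _ le.
  by rewrite nth_cat lt.
by rewrite nth_cat (leq_trans _ (Osize i.+1)).
Qed.

(** Programs print lists in rounds of several blocks each; with growing finite
    lists the blocks need not be numbered. *)
Lemma lists_chain (L : nat -> seq (word S)) (A : set (word S)) p :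
  (forall N, prefix (L N) (L N.+1)) -> (forall N, N <= size (L N)) ->
  (forall N c, c \in L N -> c = [:: one] \/ exists2 u, A u & c = enclose u) ->
  (forall u, A u -> exists N, enclose u \in L N) ->
  (forall N, initial (flatten (L N)) p) ->
  lists p A.
Proof.
move=> LS Lsize L_ok L_all Hp.
have Lpre m m' : m <= m' -> prefix (L m) (L m').
  move/subnKC => <-; elim: (m' - m) => [|l IH]; first by rewrite addn0 prefix_refl.
  by rewrite addnS (prefix_trans IH).
pose b i := nth [::] (L i.+1) i.
have bE N i : i < size (L N) -> b i = nth [::] (L N) i.
  move=> lt; rewrite /b.
  have [le|/ltnW le] := leqP N i.+1; have /prefixP[w ->] := Lpre _ _ le.
    by rewrite nth_cat lt.
  by rewrite nth_cat (leq_trans _ (Lsize i.+1)).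
exists b; split.
- by move=> i; apply: (L_ok i.+1); apply: mem_nth.
- move=> u /L_all[N uN]; exists (index (enclose u) (L N)).
  by rewrite (bE N) ?index_mem // nth_index.
- move=> N; have := Hp N; rewrite -{1}(cat_take_drop N (L N)) flatten_cat.
  have -> : mkseq b N = take N (L N).
    apply: (@eq_from_nth _ [::]) => [|i]; rewrite size_mkseq ?size_takel // => lt.
    by rewrite nth_mkseq // nth_take // -bE // (leq_trans lt).
  by case/initial_catE.
Qed.

(** Such a name, which no program provides, serves as the input on which all
    machines are made to fail. *)
Lemma lists_exist (A : set (word S)) : exists p, lists p A.
Proof.
pose b i := if unpickle i is Some u then
  if `[< A u >] then enclose u else [:: one] else [:: one].
have b_ok i : b i = [:: one] \/ exists2 u, A u & b i = enclose u.
  rewrite /b; case: unpickle => [u|]; last by left.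
  by case: asboolP => Au; [right; exists u|left].
pose L N := mkseq b N.
have LS N : prefix (L N) (L N.+1) by rewrite /L mkseqS prefix_rcons.
have [N|N|p Hp] := @chain_limit (fun N => flatten (L N)).
- by rewrite /L mkseqS flatten_rcons prefix_prefix.
- elim: N => // N IH; rewrite /L mkseqS flatten_rcons size_cat -addn1 leq_add //.
  by case: (b_ok N) => [->|[u _ ->]].
exists p; apply: (@lists_chain L) => //; first by move=> N; rewrite size_mkseq.
  by move=> N c /mapP[i _ ->].
move=> u Au; exists (pickle u).+1; apply/mapP; exists (pickle u).
  by rewrite mem_iota add0n ltnSn.
by rewrite /b pickleK; case: asboolP.
Qed.

End Names.

(** * Computability by programs *)

Section Results.
Context {S : alphabet}.

(** As results are unique, the function that a machine computes can be taken for
    the realization, whatever it is outside the names of points and sets. *)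
Lemma computable2_result k1 k2 k0 (M : machine S 2) :
  exists h : Y S k1 -> Y S k2 -> option (Y S k0), computable2 h /\
    forall y1 y2 z, h y1 y2 = Some z <-> result M (tnth [tuple tape_of y1; tape_of y2]) z.
Proof.
pose x (y1 : Y S k1) (y2 : Y S k2) := tnth [tuple tape_of y1; tape_of y2].
pose h y1 y2 : option (Y S k0) :=
  if pselect (exists z : Y S k0, result M (x y1 y2) z) is left H then Some (projT1 (cid H))
  else None.
suff H y1 y2 z : h y1 y2 = Some z <-> result M (x y1 y2) z.
  by exists h; split=> //; exists M.
rewrite /h; case: pselect => [H|nH]; last by split=> // Hz; case: nH; exists z.
case: cid => z' /= Hz'; split=> [[<-]//|Hz].
by congr Some; apply: result_unique Hz' Hz.
Qed.

Lemma multi_computable_result k1 k2 k0 X1 X2 X0 (g1 : naming S k1 X1)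
    (g2 : naming S k2 X2) (g0 : naming S k0 X0) (f : X1 -> X2 -> set X0)
    (M : machine S 2) :
  (forall y1 y2 x1 x2, g1 y1 x1 -> g2 y2 x2 -> f x1 x2 !=set0 ->
    exists2 y0 : Y S k0, result M (tnth [tuple tape_of y1; tape_of y2]) y0 &
      exists2 x0, g0 y0 x0 & f x1 x2 x0) ->
  multi_computable g1 g2 g0 f.
Proof.
move=> H; have [h [hC hP]] := computable2_result k1 k2 k0 M.
exists h; split=> // y1 y2 x1 x2 H1 H2 H12.
have [y0 Hy0 Hx0] := H _ _ _ _ H1 H2 H12.
by exists y0 => //; apply/hP.
Qed.

(** Rejection is divergence: a program that decides a set by a flag is followed
    by a loop that spins if the flag is up. *)
Lemma re_exec n k (P : prog) (fl : 'I_k) (A : set (n.-tuple (word S))) :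
  (forall t, exists w s, exec (fun i => tape_of (tnth t i : Y S Words)) P store0 w s /\
     (A t <-> ct s fl = 0)) ->
  re A.
Proof.
move=> HP; pose Q := while (fun _ z => ~~ z fl) (@basic S n k Nop).
exists (compile (seqp P Q)) => t.
pose x : inputs := fun i => tape_of (tnth t i : Y S Words); rewrite -/x.
have [w [s [E ->]]] := HP t; split=> [fl0|[w' R]].
  exists (w ++ [::]); apply: (@result_exec _ _ _ x (seqp P Q) (w ++ [::]) s).
  apply: exec_seq E _.
  by apply: exec_while0; rewrite /holds /zeros fl0.
case: (posnP (ct s fl)) => // fl_gt0; exfalso.
have loop : steps x (entry Q) s [::] (Some (entry Q)) s.
  apply: (@stepsS _ _ _ x Q None (Some tt) s Nop [::]) => /=.
    by rewrite /zeros -lt0n fl_gt0.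
  exact: (@steps1 _ _ _ x Q (Some tt) s Nop).
have runs N : exists t', N <= t' /\
   run (compile (seqp P Q)) x t' = Some (rep (Some (inr (entry Q) : pt (seqp P Q))) s w).
  elim: N => [|N [t' [le Et']]].
    by have [t' Et'] := run_steps (steps_seql Q E) (run_start x (seqp P Q)); exists (1 + t'.+1).
  have [t'' Et''] := run_steps (steps_seqr P loop) Et'.
  exists (t' + t''.+1); rewrite cats0 in Et''; split=> //.
  by rewrite addnS ltnS (leq_trans le) ?leq_addr.
case: R => t0 [c [Ec Hc _]]; have [t' [lt Et']] := runs t0.+1.
move: Et'; rewrite -(subnKC lt) addSnnS (run_add _ Ec) iterSr /= Hc.
suff -> : forall m, iter m (obind (step (M := compile (seqp P Q)) x)) None = None by [].
by elim=> // m; rewrite iterS => ->.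
Qed.

End Results.

Section Macros.
Context {S : alphabet} {n k : nat}.
Local Notation zero := (a0 S).
Local Notation one := (a1 S).
Local Notation store := (@store n k).
Local Notation prog := (@prog S n k).
Implicit Types (x : @inputs S n) (s : store) (P : prog).

Lemma setc_id s j v : ct s j = v -> setc s j v = s.
Proof. by case: s => h c /= <-; congr Store; apply/funext => l; case: eqP => // ->. Qed.

Lemma setc_setc s j v v' : setc (setc s j v) j v' = setc s j v'.
Proof. by congr Store; apply/funext => l /=; case: eqP. Qed.

Lemma setcC s j j' v v' : j != j' -> setc (setc s j v) j' v' = setc (setc s j' v') j v.
Proof.
move=> ne; congr Store; apply/funext => l /=; case: eqP => // ->.
by rewrite eq_sym (negbTE ne).
Qed.

Definition stop : prog := basic Nop.

Lemma exec_stop x s : exec x stop s [::] s. Proof. exact: exec_basic. Qed.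

Fixpoint outs (w : word S) : prog :=
  if w is a :: w' then seqp (basic (Out a)) (outs w') else stop.

Lemma exec_outs x w s : exec x (outs w) s w s.
Proof.
elim: w => [|a w IH]; first exact: exec_stop.
by rewrite -cat1s; apply: exec_seq IH; apply: exec_basic.
Qed.

End Macros.

(** * Recursively enumerable relations defined by concatenation *)

Section Concatenation.
Context {S : alphabet} {n : nat}.
Local Notation store := (@store n 1).
Local Notation prog := (@prog S n 1).
Implicit Types (s : store) (t : n.-tuple (word S)) (i j : 'I_n).

Let on_tapes t : inputs := fun i => tape_of (tnth t i : Y S Words).
Let tail t s i := drop (hd s i) (tnth t i).

Let left_over t s j := if ct s ord0 == 0 then Some (tail t s j) else None.

Let strip (v w : word S) := if prefix v w then Some (drop (size v) w) else None.

Lemma onth_ohead_drop (T : Type) (w : seq T) m : onth w m = ohead (drop m w).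
Proof. by elim: w m => [|a w IH] [|m] //=. Qed.

Let lookE t s i : look (on_tapes t) s i = ohead (tail t s i).
Proof. exact: onth_ohead_drop. Qed.

Let fail : prog := basic (Inc ord0).
Let adv i : prog := basic (Move i MRight).

Definition expect_letter j a : prog :=
  seqp (cond (fun b _ => b j == Some a) stop fail) (adv j).

Definition expect_word j w : prog := foldr (fun a P => seqp (expect_letter j a) P) stop w.

Definition expect_tape j i : prog :=
  seqp (while (fun b _ => (b i != None) && (b j == b i)) (seqp (adv i) (adv j)))
       (cond (fun b _ => b i != None) fail stop).

Definition expect j (c : word S + 'I_n) : prog :=
  match c with inl w => expect_word j w | inr i => expect_tape j i end.

Definition expect_all j (cs : seq (word S + 'I_n)) : prog :=
  seqp (foldr (fun c P => seqp (expect j c) P) stop cs)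
       (cond (fun b _ => b j != None) fail stop).

Let nxt s i : store := seth s i (hd s i).+1.

Lemma exec_expect_letter t j a s : exists s', [/\
  exec (on_tapes t) (expect_letter j a) s [::] s',
  forall l, l != j -> hd s' l = hd s l &
  left_over t s' j = obind (strip [:: a]) (left_over t s j)].
Proof.
have Hn s1 : exec (on_tapes t) (adv j) s1 [::] (nxt s1 j) by apply: exec_basic.
have tailn s1 : tail t (nxt s1 j) j = behead (tail t s1 j).
  by rewrite /tail /= eqxx -addn1 addnC -drop_drop drop1.
pose c := ohead (tail t s j) == Some a.
pose s1 := if c then s else setc s ord0 (ct s ord0).+1.
exists (nxt s1 j); split.
- rewrite -[[::]]/([::] ++ [::]); apply: exec_seq (Hn s1); apply: exec_cond.
  by rewrite /holds lookE -/c /s1; case: (c); apply: exec_basic.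
- by move=> l /negbTE lj; rewrite /= lj /s1; case: (c).
- rewrite /left_over tailn; case: (boolP c) => [/eqP|] Ec; rewrite /s1.
    move: (Ec) => /eqP; rewrite -/c => ->; move: Ec; case: (tail t s j) => //= b r [->].
    by case: ifP => //= _; rewrite /strip /= eqxx prefix0s drop0.
  rewrite (negbTE Ec) /=; move: Ec; rewrite /c; case: (tail t s j) => [|b r] /=.
    by case: ifP.
  move=> ab; have /negbTE ne : a != b by apply: contraNneq ab => ->.
  by case: ifP => //= _; rewrite /strip /= ne.
Qed.

Lemma strip_cat v w r : obind (strip w) (strip v r) = strip (v ++ w) r.
Proof.
rewrite /strip; case: prefixP => [[r' ->]|nv] /=.
  rewrite drop_size_cat //; case: prefixP => [[r'' ->]|nw].
    by rewrite catA prefix_prefix !drop_size_cat.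
  by case: prefixP => // -[r'' /eqP]; rewrite -catA eqseq_cat // eqxx => /eqP E; case: nw; exists r''.
by case: prefixP => // -[r' E]; case: nv; exists (w ++ r'); rewrite catA.
Qed.

Lemma obind_strip_cat v w (o : option (word S)) :
  obind (strip w) (obind (strip v) o) = obind (strip (v ++ w)) o.
Proof. by case: o => //= r; rewrite strip_cat. Qed.

Lemma strip_nil o : obind (strip [::]) o = o.
Proof. by case: o => //= r; rewrite /strip prefix0s drop0. Qed.

Lemma exec_expect_word t j w s : exists s', [/\
  exec (on_tapes t) (expect_word j w) s [::] s',
  forall l, l != j -> hd s' l = hd s l &
  left_over t s' j = obind (strip w) (left_over t s j)].
Proof.
elim: w s => [|a w IH] s.
  by exists s; split=> //; [exact: exec_stop|rewrite strip_nil].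
have [s1 [E1 h1 l1]] := exec_expect_letter t j a s.
have [s2 [E2 h2 l2]] := IH s1; exists s2; split.
- exact: exec_seq E1 E2.
- by move=> l lj; rewrite h2 // h1.
- by rewrite l2 l1 obind_strip_cat.
Qed.

Lemma exec_expect_tape t j i s : i != j -> hd s i = 0 -> exists s', [/\
  exec (on_tapes t) (expect_tape j i) s [::] s',
  forall l, l != j -> l != i -> hd s' l = hd s l &
  left_over t s' j = obind (strip (tnth t i)) (left_over t s j)].
Proof.
move=> ij s0; have -> : tnth t i = tail t s i by rewrite /tail s0 drop0.
rewrite /expect_tape; set P := while _ _.
have [s1 [E1 h1 c1 l1]] : exists s1, [/\ exec (on_tapes t) P s [::] s1,
    forall l, l != j -> l != i -> hd s1 l = hd s l, ct s1 = ct s &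
    if prefix (tail t s i) (tail t s j)
    then tail t s1 i = [::] /\ tail t s1 j = drop (size (tail t s i)) (tail t s j)
    else tail t s1 i <> [::]].
  have tailn s1 l l' : tail t (nxt s1 l) l' =
      if l' == l then behead (tail t s1 l') else tail t s1 l'.
    rewrite /tail /=; case: eqP => // ->.
    by rewrite -addn1 addnC -drop_drop drop1.
  move: {2}(tail t s i) (erefl (tail t s i)) => r; elim: r s {s0} => [|a r IH] s Er.
    exists s; split=> //.
      by apply: exec_while0; rewrite /holds !lookE Er.
    by rewrite Er prefix0s /= drop0.
  case Ej: (tail t s j) => [|b r'].
    exists s; split=> //; last by rewrite Er.
    by apply: exec_while0; rewrite /holds !lookE Er Ej.
  rewrite Er /=; case: (eqVneq a b) => [ab|nab] /=; last first.
    exists s; split=> //; last by rewrite Er.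
    apply: exec_while0; rewrite /holds !lookE Er Ej /=.
    by apply/negbTE; apply: contraNneq nab => -[->].
  pose s2 := nxt (nxt s i) j.
  have t2i : tail t s2 i = r by rewrite !tailn (negbTE ij) eqxx Er.
  have t2j : tail t s2 j = r' by rewrite !tailn eqxx eq_sym (negbTE ij) Ej.
  have [s3 [E3 h3 c3]] := IH s2 t2i; rewrite t2i t2j => l3.
  exists s3; split=> //.
  - rewrite -[[::]]/([::] ++ [::]); apply: exec_whileS E3.
      by rewrite /holds !lookE Er Ej /= ab eqxx.
    by rewrite -[[::]]/([::] ++ [::]); apply: exec_seq; apply: exec_basic.
  - move=> l lj li; rewrite h3 //= (negbTE lj) /= (negbTE li) //.
pose s2 := if tail t s1 i == [::] then s1 else setc s1 ord0 (ct s1 ord0).+1.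
exists s2; split.
- rewrite -[[::]]/([::] ++ [::]); apply: exec_seq E1 _; apply: exec_cond.
  rewrite /holds lookE /s2; case: (tail t s1 i) => [|a r] /=; exact: exec_basic.
- by move=> l lj li; rewrite /s2; case: ifP => _; rewrite /= h1.
- rewrite /left_over /s2; move: l1; rewrite -c1 /strip; case: ifP => /= pr.
    by case=> -> E; rewrite eqxx; case: eqP => //= _; rewrite pr -E.
  by move=> /eqP/negbTE ->; rewrite /=; case: eqP => //= _; rewrite pr.
Qed.

Lemma exec_expect t j c s : (forall i, c = inr i -> i != j /\ hd s i = 0) -> exists s', [/\
  exec (on_tapes t) (expect j c) s [::] s',
  forall l, l != j -> inr l != c -> hd s' l = hd s l &
  left_over t s' j =
    obind (strip (match c with inl w => w | inr i => tnth t i end)) (left_over t s j)].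
Proof.
case: c => [w _|i /(_ _ erefl)[ij s0]].
  by have [s' [E h l]] := exec_expect_word t j w s; exists s'; split=> // l' lj _; exact: h.
have [s' [E h l]] := exec_expect_tape t ij s0; exists s'; split=> // l' lj li; exact: h.
Qed.

(** Each tape is read once and from left to right, hence the condition that no
    tape is used twice. *)
Lemma re_concat (j : 'I_n) (cs : seq (word S + 'I_n)) :
  uniq (inr j :: cs) ->
  re [set t : n.-tuple (word S) |
      tnth t j = flatten [seq (match c with inl w => w | inr i => tnth t i end) | c <- cs]].
Proof.
move=> /andP[jcs cs_uniq]; apply: (@re_exec _ _ 1 (expect_all j cs) ord0) => t.
rewrite /expect_all /mkset -/(on_tapes t); set P := foldr _ _ _; set w := flatten _.
have [s1 [E1 l1]] : exists s1, exec (on_tapes t) P store0 [::] s1 /\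
    left_over t s1 j = obind (strip w) (left_over t store0 j).
  rewrite {}/P {}/w; have: forall i, inr i \in cs -> hd (@store0 n 1) i = 0 by [].
  elim: cs jcs cs_uniq store0 => [|c cs IH] /=.
    by move=> _ _ s _; exists s; split; [exact: exec_stop|rewrite strip_nil].
  rewrite in_cons negb_or => /andP[jc jcs] /andP[ccs cs_uniq] s s0.
  have [i Ec|s1 [E1 h1 l1]] := @exec_expect t j c s.
    by rewrite s0 ?Ec ?mem_head //; split=> //; rewrite Ec in jc; apply: contraNneq jc => ->.
  have [i ics|s2 [E2 l2]] := IH jcs cs_uniq s1.
    rewrite h1 ?s0 ?in_cons ?ics ?orbT //.
      by apply: contraNneq jcs => <-.
    by apply: contraNneq ccs => <-.
  exists s2; split; first exact: exec_seq E1 E2.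
  by rewrite l2 l1 obind_strip_cat.
pose s2 := if tail t s1 j == [::] then s1 else setc s1 ord0 (ct s1 ord0).+1.
exists ([::] ++ [::]), s2; split.
  apply: exec_seq E1 _; apply: exec_cond.
  by rewrite /holds lookE /s2; case: (tail t s1 j) => [|a r] /=; apply: exec_basic.
have -> : ct s2 ord0 = 0 <-> left_over t s1 j = Some [::].
  rewrite /s2 /left_over; case: (tail t s1 j) => [|a r] /=.
    by case: eqP.
  by case: eqP.
rewrite l1 /left_over /= /tail drop0 /strip; case: prefixP => [[r ->]|nw].
  rewrite drop_size_cat //; split=> [|[->]]; last by rewrite cats0.
  by move/eqP; rewrite -{2}(cats0 w) eqseq_cat // eqxx => /eqP ->.
by split=> // E; case: nw; exists [::]; rewrite cats0.
Qed.

End Concatenation.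

(** * Loops over counters *)

Section Loops.
Context {S : alphabet} {n k : nat}.
Local Notation zero := (a0 S).
Local Notation one := (a1 S).
Local Notation store := (@store n k).
Local Notation prog := (@prog S n k).
Implicit Types (x : @inputs S n) (s : store) (P : prog) (j l r t v K : 'I_k).

Lemma storeP s s' : hd s = hd s' -> (forall l, ct s l = ct s' l) -> s = s'.
Proof. by case: s s' => h c [h' c'] /= -> /funext ->. Qed.

Definition until0 j P : prog := while (fun _ z => ~~ z j) P.

Lemma exec_until0 x j P s (st : nat -> store) (o : nat -> word S) m :
  st 0 = s -> (forall i, i < m -> ct (st i) j != 0 /\ exec x P (st i) (o i) (st i.+1)) ->
  ct (st m) j = 0 ->
  exec x (until0 j P) s (flatten (mkseq o m)) (st m).
Proof.
elim: m s st o => [|m IH] s st o <- H Hm.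
  by apply: exec_while0; rewrite /holds /zeros Hm.
have [n0 E] := H 0 isT.
have -> : flatten (mkseq o m.+1) = o 0 ++ flatten (mkseq (fun i => o i.+1) m).
  by rewrite /mkseq /= (iotaDl 1 0) -map_comp.
apply: exec_whileS n0 E (IH _ (fun i => st i.+1) (fun i => o i.+1) erefl _ Hm) => i.
exact: (H i.+1).
Qed.

Definition move_counter K l t : prog :=
  until0 K (seqp (basic (Dec K)) (seqp (basic (Inc l)) (basic (Inc t)))).

Definition copy K l t : prog :=
  seqp (move_counter K l t) (until0 t (seqp (basic (Dec t)) (basic (Inc K)))).

Lemma flatten_nil (T : Type) m : flatten (mkseq (fun=> [::] : seq T) m) = [::].
Proof. by elim: m => // m IH; rewrite mkseqS flatten_rcons IH. Qed.

Lemma exec_copy x K l t s : uniq [:: K; l; t] -> ct s l = 0 -> ct s t = 0 ->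
  exec x (copy K l t) s [::] (setc s l (ct s K)).
Proof.
rewrite /= !inE negb_or => /and3P[/andP[Kl Kt] lt _] l0 t0; pose m := ct s K.
pose st i := setc (setc (setc s K (m - i)) l i) t i.
have E1 : exec x (move_counter K l t) s [::] (st m).
  rewrite -(flatten_nil S m); apply: exec_until0.
  - apply: storeP => // l' /=; rewrite subn0.
    by case: eqP => [->|]; rewrite ?t0 //; case: eqP => [->|]; rewrite ?l0 //; case: eqP => [->|].
  - move=> i lti; rewrite /= (negbTE Kt) (negbTE Kl) eqxx -lt0n subn_gt0; split=> //.
    rewrite -[[::]]/([::] ++ ([::] ++ [::])).
    apply: exec_seq; first exact: exec_basic.
    apply: exec_seq; first exact: exec_basic.
    suff -> : st i.+1 = @do_op S n k (Inc t) (@do_op S n k (Inc l) (@do_op S n k (Dec K) (st i))) by exact: exec_basic.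
    apply: storeP => // l' /=; rewrite !eqxx (negbTE Kt) (negbTE Kl) (negbTE lt).
    rewrite ![t == _]eq_sym ![l == K]eq_sym (negbTE Kt) (negbTE Kl) (negbTE lt) subnS.
    by do !case: eqP => // _.
  - by rewrite /= (negbTE Kt) (negbTE Kl) eqxx subnn.
pose st' i := setc (setc (setc s K i) l m) t (m - i).
rewrite -[[::]]/([::] ++ [::]); apply: exec_seq E1 _.
have -> : setc s l m = st' m.
  apply: storeP => // l' /=; rewrite subnn.
  by case: (eqVneq l' t) => [->|_]; rewrite ?t0 ?[t == l]eq_sym ?(negbTE lt) //; case: eqP => // _; case: eqP => [->|].
rewrite -(flatten_nil S m); apply: exec_until0.
- by apply: storeP => // l' /=; rewrite subnn subn0.
- move=> i lti; rewrite /= eqxx -lt0n subn_gt0; split=> //.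
  rewrite -[[::]]/([::] ++ [::]).
  apply: exec_seq; first exact: exec_basic.
  suff -> : st' i.+1 = @do_op S n k (Inc K) (@do_op S n k (Dec t) (st' i)) by exact: exec_basic.
  apply: storeP => // l' /=; rewrite !eqxx (negbTE Kt) (negbTE Kl) subnS.
  case: (eqVneq l' K) => [->|_]; first by rewrite (negbTE Kt) (negbTE Kl).
  by do !case: eqP => // _.
- by rewrite /= eqxx subnn.
Qed.

Definition for_loop K v l t P : prog :=
  seqp (copy K l t) (seqp (until0 l (seqp (basic (Dec l)) (seqp P (basic (Inc v)))))
                          (until0 v (basic (Dec v)))).

Lemma exec_for_loop x K v l t P s (o : nat -> word S) :
  uniq [:: K; v; l; t] -> ct s v = 0 -> ct s l = 0 -> ct s t = 0 ->
  (forall i m, i < ct s K ->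
     exec x P (setc (setc s v i) l m) (o i) (setc (setc s v i) l m)) ->
  exec x (for_loop K v l t P) s (flatten (mkseq o (ct s K))) s.
Proof.
rewrite /= !inE !negb_or => /and4P[/and3P[Kv Kl Kt] /andP[vl vt] lt _] v0 l0 t0 HP.
pose m := ct s K; rewrite -/m in HP *.
rewrite -[flatten _]cat0s -[flatten _]cats0; apply: exec_seq.
  by apply: exec_copy => //; rewrite /= !inE negb_or Kl Kt lt.
rewrite -/m; pose st i := setc (setc s v i) l (m - i).
apply: (@exec_seq _ _ _ x _ _ _ _ (st m)).
  apply: exec_until0.
  - apply: storeP => // l' /=; rewrite subn0.
    by case: eqP => // _; case: eqP => [->|].
  - move=> i lti; rewrite /= eqxx -lt0n subn_gt0; split=> //.
    rewrite -[o i]cat0s -[o i]cats0.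
    apply: exec_seq; first exact: exec_basic.
    apply: (@exec_seq _ _ _ x _ _ _ _ (setc (setc s v i) l (m - i.+1))).
      suff -> : @do_op S n k (Dec l) (st i) = setc (setc s v i) l (m - i.+1) by exact: HP.
      by rewrite /= eqxx setc_setc subnS.
    suff -> : st i.+1 = @do_op S n k (Inc v) (setc (setc s v i) l (m - i.+1)) by exact: exec_basic.
    by rewrite /= (negbTE vl) eqxx [RHS]setcC 1?eq_sym // setc_setc.
  - by rewrite /= eqxx subnn.
pose st' i := setc s v (m - i).
have -> : s = st' m by rewrite /st' subnn setc_id.
rewrite -(flatten_nil S m); apply: exec_until0.
- by rewrite /st' subn0 /st subnn [RHS]setc_id //= eq_sym (negbTE vl).
- move=> i lti; rewrite /= eqxx -lt0n subn_gt0; split=> //.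
  suff -> : st' i.+1 = @do_op S n k (Dec v) (st' i) by exact: exec_basic.
  by rewrite /= eqxx setc_setc /st' subnS.
- by rewrite /= eqxx subnn.
Qed.

End Loops.

(** * Printing *)

Section Printing.
Context {S : alphabet}.
Local Notation zero := (a0 S).
Local Notation one := (a1 S).

(** Descriptions of words by nested loops. The second arguments of [text] below
    are the values of the variables, the innermost loop variable first; the
    number in [For] is the index of the variable that bounds the loop. [Block]
    leaves the word unchanged and delimits an item of a printed list. *)
Inductive printer :=
| Lit of word S
| Cat of printer & printer
| For of nat & printer
| Block of printer.

Fixpoint text (e : printer) (v : seq nat) : word S :=
  match e with
  | Lit w => w
  | Cat e1 e2 => text e1 v ++ text e2 v
  | For l e1 => flatten (mkseq (fun i => text e1 (i :: v)) (nth 0 v l))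
  | Block e1 => text e1 v
  end.

Lemma text_Cat e1 e2 v : text (Cat e1 e2) v = text e1 v ++ text e2 v.
Proof. by []. Qed.

Fixpoint items (e : printer) (v : seq nat) : seq (word S) :=
  match e with
  | Lit w => [:: w]
  | Cat e1 e2 => items e1 v ++ items e2 v
  | For l e1 => flatten (mkseq (fun i => items e1 (i :: v)) (nth 0 v l))
  | Block e1 => [:: text e1 v]
  end.

Lemma flatten_items e v : flatten (items e v) = text e v.
Proof.
elim: e v => [w|e1 IH1 e2 IH2|l e IH|e _] v //=; rewrite ?cats0 //.
  by rewrite flatten_cat IH1 IH2.
elim: (nth 0 v l) => // m IHm; rewrite !mkseqS !flatten_rcons flatten_cat IHm.
by rewrite IH.
Qed.

Fixpoint wf d (e : printer) : bool :=
  match e with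
  | Lit _ => true
  | Cat e1 e2 => wf d e1 && wf d e2
  | For l e1 => (l < d) && wf d.+1 e1
  | Block e1 => wf d e1
  end.

Fixpoint depth (e : printer) : nat :=
  match e with
  | Lit _ => 0
  | Cat e1 e2 => maxn (depth e1) (depth e2)
  | For _ e1 => (depth e1).+1
  | Block e1 => depth e1
  end.

Context {n k : nat}.

(** The numbers are held by the counters [env]; each loop takes two of the
    counters [fresh] and gives them back as zero. *)
Fixpoint print (t : 'I_k) (env fresh : seq 'I_k) (e : printer) : @prog S n k :=
  match e with
  | Lit w => outs w
  | Cat e1 e2 => seqp (print t env fresh e1) (print t env fresh e2)
  | For l e1 =>
      if fresh is v :: r :: fresh' then
        for_loop (nth t env l) v r t (print t (v :: env) fresh' e1)
      else stop
  | Block e1 => print t env fresh e1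
  end.

Lemma exec_print x t env fresh e s : uniq (t :: env ++ fresh) ->
  wf (size env) e -> (depth e).*2 <= size fresh ->
  ct s t = 0 -> {in fresh, forall l, ct s l = 0} ->
  exec x (print t env fresh e) s (text e (map (ct s) env)) s.
Proof.
elim: e env fresh s => [w|e1 IH1 e2 IH2|l e IH|e IH] env fresh s //=.
- by move=> *; apply: exec_outs.
- move=> Hu /andP[w1 w2] le t0 f0.
  have le1 : (depth e1).*2 <= size fresh.
    by apply: leq_trans le; rewrite leq_double leq_maxl.
  have le2 : (depth e2).*2 <= size fresh.
    by apply: leq_trans le; rewrite leq_double leq_maxr.
  by apply: exec_seq; [exact: IH1|exact: IH2].
- case: fresh => [|v [|r fresh]] //= Hu /andP[lt w1]; rewrite doubleS !ltnS => le t0 f0.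
  pose K := nth t env l; have Kenv : K \in env by rewrite mem_nth.
  rewrite (nth_map t) // -/K.
  move: Hu; rewrite mem_cat !inE !negb_or cat_uniq /= !inE !negb_or.
  move=> /andP[/and4P[tenv tv tr tf] /and4P[uenv nhas /andP[vr vf] /andP[rf uf]]].
  move: nhas => /and3P[venv renv nhas].
  apply: exec_for_loop => //.
  - rewrite /= !inE !negb_or vr ![_ == t]eq_sym tv tr /= !andbT.
    by rewrite -/K; apply/and3P; split; [apply: contraNneq venv => <-|apply: contraNneq renv => <-|apply: contraNneq tenv => ->].
  - by rewrite f0 // inE eqxx.
  - by rewrite f0 // !inE eqxx orbT.
  move=> i m _; set s' := setc _ r m.
  have -> : i :: [seq ct s l0 | l0 <- env] = map (ct s') (v :: env).
    rewrite /= (negbTE vr) eqxx; congr cons.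
    apply/eq_in_map => l' l'env /=.
    by case: eqP => [E|_]; [rewrite E (negbTE renv) in l'env|case: eqP => // E; rewrite E (negbTE venv) in l'env].
  apply: IH => //=.
  + rewrite inE mem_cat !negb_or tv tenv tf /= mem_cat negb_or venv vf cat_uniq uenv uf.
    by rewrite nhas.
  + by rewrite (negbTE tr) (negbTE tv).
  + move=> l' l'f; rewrite f0 ?inE ?l'f ?orbT //.
    case: eqP => [E|_]; first by rewrite -E l'f in rf.
    by case: eqP => [E|_]; first by rewrite -E l'f in vf.
- exact: IH.
Qed.

(** Enclosing is done letter by letter, so it can be done to a description
    instead of the word described. *)
Fixpoint spread_printer (e : printer) : printer :=
  match e with
  | Lit w => Lit (spread w)
  | Cat e1 e2 => Cat (spread_printer e1) (spread_printer e2)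
  | For l e1 => For l (spread_printer e1)
  | Block e1 => Block (spread_printer e1)
  end.

Lemma text_spread e v : text (spread_printer e) v = spread (text e v).
Proof.
elim: e v => [w|e1 IH1 e2 IH2|l e IH|e IH] v //=; first by rewrite IH1 IH2 spread_cat.
elim: (nth 0 v l) => // m IHm; rewrite !mkseqS !flatten_rcons spread_cat IHm.
by rewrite IH.
Qed.

Definition Enclose (e : printer) : printer :=
  Cat (Lit [:: one; one]) (Cat (spread_printer e) (Lit [:: zero; one; one])).

Lemma text_Enclose e v : text (Enclose e) v = enclose (text e v).
Proof. by rewrite /= text_spread. Qed.

End Printing.

(** * Reading the first number of a name *)

Section Reading.
Context {S : alphabet}.
Local Notation zero := (a0 S).
Local Notation one := (a1 S).

Definition ending (b : bool) : word S := if b then [:: one; one] else [:: zero].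

(** A list of enclosed words begins like this if [j] ones of padding come first
    and the first word begins with [m] ones, followed by the end of the word if
    [b] holds and by a zero otherwise. *)
Definition front (j m : nat) (b : bool) : word S :=
  nseq j one ++ [:: one; one; zero] ++ flatten (nseq m [:: one; zero]) ++ ending b.

Lemma initial_step a w (p : sequence S) h : initial (a :: w) (fun l => p (h + l)) <->
  p h = a /\ initial w (fun l => p (h.+1 + l)).
Proof.
rewrite initial_cons addn0.
by have -> : (fun l => p (h + l.+1)) = (fun l => p (h.+1 + l)) by apply/funext => l; rewrite addSnnS.
Qed.

(** The place of the first zero gives the padding away. After it the ones that
    are counted alternate with zeros, and the first place where the alternation
    fails ends the count. *)
Lemma front_uniq (p : sequence S) j m b j' m' b' :
  initial (front j m b) p -> initial (front j' m' b') p -> m = m'.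
Proof.
rewrite -[p]/(fun l => p (0 + l)); have nz : one <> zero by apply/eqP/one_neq_zero.
elim: j j' (0) => [|j IH] [|j'] h; rewrite /front.
- do 3 (rewrite initial_step => -[_ +]); move=> + /initial_step[_ /initial_step[_ /initial_step[_]]].
  elim: m m' (h.+3) => [|m IH] [|m'] {}h //=.
  + case: b; rewrite /= !initial_step.
      by move=> [_ [E _]] [_ [E' _]]; case: nz; rewrite -E -E'.
    by move=> [E _] [E' _]; case: nz; rewrite -E -E'.
  + case: b' {IH}; rewrite /= !initial_step.
      by move=> [_ [E' _]] [_ [E _]]; case: nz; rewrite -E -E'.
    by move=> [E' _] [E _]; case: nz; rewrite -E -E'.
  + by rewrite !initial_step => -[_ [_ H]] [_ [_ /(IH _ _ H)->]].
- rewrite /= !initial_step => -[_ [_ [E _]]] [_ H].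
  by case: j' H => [|[|j']] /=; rewrite !initial_step => -[_ [E' _]]; case: nz; rewrite -E -E'.
- rewrite /= !initial_step => -[_ H] [_ [_ [E _]]].
  by case: j {IH} H => [|[|j]] /=; rewrite !initial_step => -[_ [E' _]]; case: nz; rewrite -E -E'.
- by rewrite /= !initial_step => -[_ H] [_]; apply: IH.
Qed.

Context {n k : nat}.
Local Notation store := (@store n k).
Local Notation prog := (@prog S n k).

Definition is_one (i : 'I_n) : @test S n k := fun a _ => a i == Some one.
Definition adv (i : 'I_n) : prog := basic (Move i MRight).

Definition skip_ones i : prog := while (is_one i) (adv i).

Definition count_ones i (c f : 'I_k) : prog :=
  while (fun a z => is_one i a z && z f)
    (seqp (adv i) (cond (is_one i) (basic (Inc f)) (seqp (basic (Inc c)) (adv i)))).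

(** A one that is a letter of the word is followed by a zero, and only the end of
    the word shows two ones in a row; in this case the flag [f] stops the loop. *)
Definition read_number i (c f : 'I_k) : prog :=
  seqp (skip_ones i) (seqp (adv i) (seqp (count_ones i c f) (basic (Dec f)))).

Variables (x : @inputs S n) (i : 'I_n) (p : sequence S).
Hypothesis xi : forall m, x i m = Some (p m).

Let is_oneE (s : store) : holds x s (is_one i) = (p (hd s i) == one).
Proof. by rewrite /holds /is_one /look xi. Qed.

Let exec_adv (s : store) : exec x (adv i) s [::] (seth s i (hd s i).+1).
Proof. exact: exec_basic. Qed.

Let seth_seth (s : store) v v' : seth (seth s i v) i v' = seth s i v'.
Proof. by congr Store; apply/funext => l /=; case: eqP. Qed.

Let seth_id (s : store) : seth s i (hd s i) = s.
Proof. by case: s => h c; congr Store; apply/funext => l /=; case: eqP => // ->. Qed.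

Lemma exec_skip_ones (s : store) m r :
  initial (nseq m one ++ zero :: r) (fun l => p (hd s i + l)) ->
  exec x (skip_ones i) s [::] (seth s i (hd s i + m)).
Proof.
elim: m s => [|m IH] s /= /initial_step[E H].
  rewrite addn0 seth_id; apply: exec_while0; rewrite is_oneE E.
  by apply/negbTE; rewrite a0_neq_a1.
rewrite -[[::]]/([::] ++ [::]); apply: exec_whileS (exec_adv s) _.
  by rewrite is_oneE E.
have := IH (seth s i (hd s i).+1); rewrite seth_seth /= eqxx addSnnS.
exact.
Qed.

Lemma exec_count_ones (s : store) c f m b : c != f -> ct s f = 0 ->
  initial (flatten (nseq m [:: one; zero]) ++ ending b) (fun l => p (hd s i + l)) ->
  exists h, exec x (count_ones i c f) s [::]
    (setc (setc (seth s i h) c (ct s c + m)) f b).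
Proof.
move=> cf; pose t : @test S n k := fun a z => is_one i a z && z f.
pose B := seqp (adv i) (cond (is_one i) (basic (Inc f)) (seqp (basic (Inc c)) (adv i))).
rewrite -[count_ones i c f]/(while t B).
have tE s' : holds x s' t = (p (hd s' i) == one) && (ct s' f == 0).
  by rewrite -is_oneE.
elim: m s => [|m IH] s f0.
  rewrite addn0; case: b => /= /initial_step[E H].
    exists (hd s i).+1; rewrite -[[::]]/(([::] ++ [::]) ++ [::]).
    apply: exec_whileS; first by rewrite tE E f0 !eqxx.
      apply: exec_seq (exec_adv s) _; apply: exec_cond.
      rewrite is_oneE /= eqxx; move/initial_step: H => [-> _]; rewrite eqxx.
      exact: exec_basic.
    have -> : do_op (Inc f : @op S n k) (seth s i (hd s i).+1) =
        setc (setc (seth s i (hd s i).+1) c (ct s c)) f true.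
      by rewrite /= f0 [setc _ c _]setc_id.
    by apply: exec_while0; rewrite tE /= !eqxx andbF.
  exists (hd s i); rewrite seth_id setc_id // setc_id ?setc_id //.
    by apply: exec_while0; rewrite tE E (negbTE (a0_neq_a1 S)).
rewrite /= => /initial_step[E /initial_step[E' H]].
pose s' := setc (seth s i (hd s i).+2) c (ct s c).+1.
have s'h : hd s' i = (hd s i).+2 by rewrite /= eqxx.
have s'f : ct s' f = 0 by rewrite /= eq_sym (negbTE cf).
have [//||h Eh] := IH s'; rewrite ?s'h //.
exists h; rewrite -[[::]]/(([::] ++ ([::] ++ [::])) ++ [::]).
apply: (@exec_whileS _ _ _ x t B s _ s'); first by rewrite tE E f0 !eqxx.
  apply: exec_seq (exec_adv s) _; apply: exec_cond.
  rewrite is_oneE /= eqxx E' (negbTE (a0_neq_a1 S)).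
  rewrite -[[::]]/([::] ++ [::]); apply: exec_seq; first exact: exec_basic.
  have -> : s' = do_op (Move i MRight : @op S n k)
      (do_op (Inc c : @op S n k) (seth s i (hd s i).+1)).
    by rewrite /= eqxx /s' -(seth_seth s (hd s i).+1 (hd s i).+2).
  exact: exec_basic.
suff <- : setc (setc (seth s' i h) c (ct s' c + m)) f b =
    setc (setc (seth s i h) c (ct s c + m.+1)) f b by exact: Eh.
rewrite -[seth s' i h]/(setc (seth (seth s i (hd s i).+2) i h) c (ct s c).+1).
by rewrite setc_setc seth_seth /= eqxx addSnnS.
Qed.

Lemma exec_read_number (s : store) c f j m b : c != f -> hd s i = 0 ->
  ct s c = 0 -> ct s f = 0 -> initial (front j m b) p ->
  exists h, exec x (read_number i c f) s [::] (setc (seth s i h) c m).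
Proof.
move=> cf h0 c0 f0; rewrite -[p]/(fun l => p (0 + l)) => Hp.
have H1 : initial (nseq j.+2 one ++ zero :: flatten (nseq m [:: one; zero]) ++ ending b)
    (fun l => p (hd s i + l)).
  rewrite h0; move: Hp; rewrite /front.
  by rewrite -[_ :: _]/(nseq 2 one ++ [:: zero]) -catA catA -nseqD addn2.
pose s1 := seth s i j.+2; pose s2 := seth s i j.+3.
have E1 : exec x (skip_ones i) s [::] s1 by have := exec_skip_ones H1; rewrite h0.
have E2 : exec x (adv i) s1 [::] s2.
  by have := exec_adv s1; rewrite seth_seth /= eqxx.
have [||h E3] := @exec_count_ones s2 c f m b cf; rewrite /= ?eqxx //.
  have -> : (fun l => p (j.+3 + l)) = (fun l => (fun l' => p (hd s i + l')) (j.+3 + l)).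
    by rewrite h0.
  move: H1; rewrite -cat_rcons => /initial_catE[_].
  by rewrite size_rcons size_nseq.
exists h; rewrite -[[::]]/([::] ++ ([::] ++ ([::] ++ [::]))).
apply: exec_seq E1 (exec_seq E2 (exec_seq E3 _)).
have -> : setc (seth s i h) c m = do_op (Dec f : @op S n k)
    (setc (setc (seth s2 i h) c (ct s2 c + m)) f b).
  rewrite /= eqxx setc_setc /s2 seth_seth c0 add0n; symmetry; apply: setc_id.
  by rewrite /= eq_sym (negbTE cf) f0; case: (b).
exact: exec_basic.
Qed.

End Reading.

(** * Spaces with a basis closed under intersection *)

Section Constant.
Context {S : alphabet}.

Lemma result_outs n x (w : word S) :
  result (compile (@outs S n 0 w)) x (w : Y S Words).
Proof. exact: (result_exec (exec_outs x w store0)). Qed.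

Lemma recursive_setT (A : set (word S)) : (forall u, A u) -> recursive A.
Proof.
move=> AT; exists (compile (@outs S 1 0 [:: a1 S])) => y z.
case: asboolP => // _; split=> [[<-]|H]; first exact: result_outs.
by congr Some; apply: (result_unique (result_outs _ _) H).
Qed.

End Constant.

(** If intersections of basis sets are named by concatenation, the axioms of a
    computable topological space hold whatever the sets are: all that is not
    effective about a space may be put into its points. *)
Record presentation (S : alphabet) := Presentation {
  carrier : choiceType;
  sep : word S;
  named : word S -> set carrier;
  named_cat : forall u v, named (u ++ sep ++ v) = named u `&` named v;
  named_cover : forall x, exists u, named u x;
  named_T0 : forall x y, x <> y ->
    exists u, (named u x /\ ~ named u y) \/ (~ named u x /\ named u y) }.

Arguments named {S} p u.

Section Space.
Context {S : alphabet} (P : presentation S).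

Definition pspace : Type := carrier P.
HB.instance Definition _ := Choice.on pspace.

Definition popen : set_system pspace :=
  [set A | forall x, A x -> exists u, named P u x /\ named P u `<=` A].

Lemma popenT : popen setT.
Proof. by move=> x _; have [u ux] := named_cover x; exists u. Qed.

Lemma popenI : setI_closed popen.
Proof.
move=> A B HA HB x [/HA[u [ux uA]] /HB[v [vx vB]]].
exists (u ++ sep P ++ v); rewrite named_cat; split=> // y [/uA yA /vB yB]; by [].
Qed.

Lemma popen_bigU (I : Type) (f : I -> set pspace) : (forall i, popen (f i)) ->
  popen (\bigcup_i f i).
Proof.
move=> Hf x [i _ /Hf[u [ux uf]]]; exists u; split=> // y /uf fy.
by exists i.
Qed.

HB.instance Definition _ := isOpenTopological.Build pspace popenT popenI popen_bigU.

Lemma openP (A : set pspace) : open A <->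
  forall x, A x -> exists u, named P u x /\ named P u `<=` A.
Proof. by []. Qed.

Lemma open_named u : open (named P u : set pspace).
Proof. by apply/openP => x ux; exists u; split. Qed.

Lemma nbhsP (x : pspace) A : nbhs x A <-> exists u, named P u x /\ named P u `<=` A.
Proof.
split=> [[B [Bop Bx BA]]|[u [ux uA]]].
  have [u [ux uB]] := Bop x Bx; exists u; split=> //.
  exact: subset_trans BA.
by exists (named P u); split=> //; apply: open_named.
Qed.

Lemma pspace_T0 : kolmogorov_space pspace.
Proof.
move=> x y /eqP/named_T0[u [[ux uy]|[ux uy]]]; exists (named P u); [left|right];
  by split; apply/mem_set => //; apply/nbhsP; exists u; split.
Qed.

Lemma pspace_basis :
  basis [set U : set pspace | exists u, Some (named P u) = Some U].
Proof.
split=> [U [u [<-]]|x A /nbhsP[u [ux uA]]]; first exact: open_named.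
by exists (named P u) => //; split=> //; exists u.
Qed.

Lemma pspace_inter : exists I : set (3.-tuple (word S)),
   [/\ re I,
       forall u v w, I [tuple u; v; w] -> [/\ true, true & true] &
       forall u v, true -> true -> named P u `&` named P v =
         \bigcup_(w in [set w | I [tuple u; v; w]]) (named P w : set pspace)].
Proof.
pose i0 : 'I_3 := inord 0; pose i1 : 'I_3 := inord 1; pose i2 : 'I_3 := inord 2.
have := @re_concat S 3 i2 [:: inr i0; inl (sep P); inr i1].
set I := [set t | _] => H; exists I; split=> //.
  apply: H; rewrite /= !inE !(inj_eq (@inr_inj _ _)) /=.
  by rewrite -!val_eqE /= !inordK.
have IE u v w : I [tuple u; v; w] <-> w = u ++ sep P ++ v.
  by rewrite /I /= cats0 !(tnth_nth [::]) /= !inordK.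
move=> u v _ _; rewrite -named_cat; apply/seteqP; split=> [x ux|x [w /IE -> //]].
by exists (u ++ sep P ++ v) => //; apply/IE.
Qed.

Definition presented : ctspace S :=
  @CTSpace S pspace (fun u => Some (named P u)) pspace_T0 pspace_basis
    (recursive_setT (fun=> isT)) pspace_inter.

End Space.

(** * Spaces with a numbered subbasis *)

Section Pieces.
Context {S : alphabet}.
Local Notation zero := (a0 S).
Local Notation one := (a1 S).

(** Words stand for nonempty lists of numbers in unary notation, in such a way
    that concatenation with a zero in between is the concatenation of lists. *)
Definition pieces (u : word S) : seq nat :=
  foldr (fun a s => if a == zero then 0 :: s else (head 0 s).+1 :: behead s) [:: 0] u.

Lemma pieces_cat u v : pieces (u ++ [:: zero] ++ v) = pieces u ++ pieces v.
Proof.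
have pn u' : exists m s, pieces u' = m :: s.
  elim: u' => [|a u' [m [s E]]]; first by exists 0, [::].
  by rewrite /= E; case: ifP => _; [exists 0, (m :: s)|exists m.+1, s].
elim: u => [|a u IH] /=; first by rewrite eqxx.
rewrite -[_ :: v]/([:: zero] ++ v) IH; case: ifP => // _.
by have [m [s ->]] := pn u.
Qed.

Lemma pieces_ones m : pieces (nseq m one) = [:: m].
Proof. by elim: m => //= m ->; rewrite (negbTE (one_neq_zero)). Qed.

Lemma pieces_cons_one u : pieces (one :: u) = (head 0 (pieces u)).+1 :: behead (pieces u).
Proof. by rewrite /= (negbTE (one_neq_zero)). Qed.

Definition binary (u : word S) : bool := all (fun a => (a == zero) || (a == one)) u.

Lemma enclose_front u : binary u -> exists b r,
  enclose u = front 0 (head 0 (pieces u)) b ++ r.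
Proof.
move=> bu; suff [b [r E]] : exists b r, spread u ++ [:: zero; one; one] =
    zero :: flatten (nseq (head 0 (pieces u)) [:: one; zero]) ++ ending b ++ r.
  by exists b, r; rewrite encloseE E /front /= -catA.
elim: u bu => [_|a u IH /andP[/orP[]/eqP -> bu]].
- by exists true, [::].
- by exists false, (spread u ++ [:: zero; one; one]); rewrite /= eqxx.
- have [b [r E]] := IH bu; exists b, r.
  by rewrite pieces_cons_one /= -[RHS]/([:: zero; one] ++ zero :: _) -E.
Qed.

Section Numbered.
Variables (X : choiceType) (sigma : nat -> set X).

Definition of_pieces (u : word S) : set X :=
  [set x | binary u /\ {in pieces u, forall m, sigma m x}].

Lemma of_pieces_cat u v :
  of_pieces (u ++ [:: zero] ++ v) = of_pieces u `&` of_pieces v.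
Proof.
rewrite /of_pieces pieces_cat /binary !all_cat /= eqxx /=.
apply/seteqP; split=> x /=.
  move=> [/andP[-> ->] H]; split; split=> // m mu; apply: H; by rewrite mem_cat mu ?orbT.
move=> [[-> H] [-> H']]; split=> // m; rewrite mem_cat => /orP[]; [exact: H|exact: H'].
Qed.

Lemma of_pieces_ones m : of_pieces (nseq m one) = sigma m.
Proof.
rewrite /of_pieces pieces_ones; apply/seteqP; split=> x /=.
  by move=> [_ /(_ m)]; apply; rewrite mem_head.
move=> mx; split; first by apply/allP => a /nseqP[-> _]; rewrite eqxx orbT.
by move=> m'; rewrite inE => /eqP ->.
Qed.

Hypothesis sigma_cover : forall x, exists m, sigma m x.
Hypothesis sigma_T0 : forall x y, x <> y ->
  exists m, (sigma m x /\ ~ sigma m y) \/ (~ sigma m x /\ sigma m y).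

Lemma of_pieces_cover x : exists u, of_pieces u x.
Proof. by have [m mx] := sigma_cover x; exists (nseq m one); rewrite of_pieces_ones. Qed.

Lemma of_pieces_T0 x y : x <> y -> exists u,
  (of_pieces u x /\ ~ of_pieces u y) \/ (~ of_pieces u x /\ of_pieces u y).
Proof. by move=> /sigma_T0[m H]; exists (nseq m one); rewrite of_pieces_ones. Qed.

Definition numbered : ctspace S := presented
  (@Presentation S X [:: zero] of_pieces of_pieces_cat of_pieces_cover of_pieces_T0).

(** All the words in a name are those of basis sets containing the point, and a
    basis set is contained in the subbasis sets whose numbers its word lists; so
    the first piece of the first word is the number of a set to which the point
    belongs. *)
Lemma delta_front p (x : numbered) : delta p x -> exists j m b,
  initial (front j m b) p /\ sigma m x.
Proof.
move=> [b [b_ok b_all Hp]]; have [u ux] := of_pieces_cover x.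
have b_ex : exists i, b i != [:: one].
  by have [i E] := b_all u ux; exists i; rewrite E encloseE eqseq_cons andbF.
case: (ex_minnP b_ex) => j bj min_j.
have b1 i : i < j -> b i = [:: one].
  by move=> lt; apply/eqP; apply: contraTT lt => /min_j; rewrite -leqNgt.
case: (b_ok j) => [E|[v vx E]]; first by move: bj; rewrite E eqxx.
have [bv Hv] : of_pieces v x by [].
have [e [r Ev]] := enclose_front bv.
exists j, (head 0 (pieces v)), e; split; last first.
  by apply: Hv; case: (v) => [|a w] /=; [|case: ifP => _ /=]; rewrite inE eqxx.
have := Hp j.+1; rewrite mkseqS flatten_rcons (padding_only b1) E Ev catA => /initial_catE[+ _].
by rewrite /front.
Qed.

Lemma openD : (forall m x y, sigma m x -> sigma m y -> x = y) -> D numbered.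
Proof.
move=> sub A; apply/openP => x Ax; have [m mx] := sigma_cover x.
exists (nseq m one); rewrite /= of_pieces_ones; split=> // y my.
by rewrite (sub _ _ _ my mx).
Qed.

End Numbered.

End Pieces.

(** * The Sierpinski space *)

Section Sierpinski.
Context {S : alphabet}.
Local Notation zero := (a0 S).
Local Notation one := (a1 S).

Definition sierpinski_set (u : word S) : set bool := [set x | nilp u || x].

Lemma sierpinski_cat u v :
  sierpinski_set (u ++ [::] ++ v) = sierpinski_set u `&` sierpinski_set v.
Proof.
apply/seteqP; split=> x; rewrite /sierpinski_set /= /nilp size_cat addn_eq0;
  by case: eqP; case: eqP; case: x => // _ _ [].
Qed.

Lemma sierpinski_cover x : exists u, sierpinski_set u x.
Proof. by exists [::]. Qed.

Lemma sierpinski_T0 x y : x <> y -> exists u,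
  (sierpinski_set u x /\ ~ sierpinski_set u y) \/
  (~ sierpinski_set u x /\ sierpinski_set u y).
Proof. by exists [:: zero]; case: x y H => [] [] // _; [left|right]. Qed.

Definition sierpinski : ctspace S := presented
  (@Presentation S bool [::] sierpinski_set sierpinski_cat sierpinski_cover sierpinski_T0).

Lemma sierpinski_CT0 : CT0 sierpinski.
Proof.
apply: (multi_computable_result (M := compile (@outs S 2 0 [:: one]))).
move=> y1 y2 x1 x2 _ _ [U [_ HU]]; exists [:: one]; first exact: result_outs.
exists (sierpinski_set [:: one]) => //; split; first by exists [:: one].
by case: x1 x2 HU => [] [] /=; [case=> [] []|left|right|case=> [] []].
Qed.

Lemma sierpinski_notT1 : ~ T1 sierpinski.
Proof.
move=> /(_ (false : sierpinski) (true : sierpinski) isT)[A [Aop /set_mem Af /set_mem At]].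
have [u [/= uf uA]] := Aop _ Af; apply: At; apply: uA.
by move: uf; rewrite /sierpinski_set /= orbF => ->.
Qed.

Lemma lists_ones (p : sequence S) : (forall m, p m = one) -> lists p set0.
Proof.
move=> p1; exists (fun=> [:: one]); split=> [i|u []|n]; first by left.
rewrite padding_only //; apply/initialP => i; rewrite size_nseq => lt.
by rewrite p1 nth_nseq lt.
Qed.

Lemma lists_one_zero (p : sequence S) r :
  (forall m, p m = if m == r.+2 then zero else one) -> lists p [set [::]].
Proof.
move=> pE; exists (fun i => if i == r then enclose [::] else [:: one]); split.
- by move=> i; case: eqP => _; [right; exists [::]|left].
- by move=> u ->; exists r; rewrite eqxx.
move=> n; have [le|lt] := leqP n r.
  rewrite padding_only => [|i lti]; last by rewrite ltn_eqF // (leq_trans lti).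
  apply/initialP => i; rewrite size_nseq => lti; rewrite nth_nseq lti pE.
  by rewrite ltn_eqF // (leq_trans lti) // (leq_trans le) // leqW.
rewrite -(subnKC lt) /mkseq iotaD map_cat flatten_cat -/(mkseq _ r.+1) mkseqS.
rewrite eqxx flatten_rcons padding_only => [|i lti]; last by rewrite ltn_eqF.
have -> : flatten [seq (if i == r then enclose [::] else [:: one]) | i <- iota (0 + r.+1) (n - r.+1)]
    = nseq (n - r.+1) one.
  rewrite add0n -[r.+1]addn0 iotaDl -map_comp addn0; apply: padding_only => i _ /=.
  by rewrite gtn_eqF // ltnS leq_addr.
apply/initialP => i; rewrite pE -catA nth_cat size_nseq.
case: (ltnP i r) => [lti _|le]; first by rewrite nth_nseq lti ltn_eqF // (leq_trans lti) // leqW.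
move=> lt'; rewrite -{2}(subnKC le) -addn2 eqn_add2l.
move: lt'; rewrite -{1}(subnKC le) !size_cat !size_nseq ltn_add2l.
case: (i - r) => [|[|[|[|[|m]]]]] //=; rewrite !ltnS nth_nseq.
by move=> ->.
Qed.

Let i0 : 'I_2 := ord0.
Let i1 : 'I_2 := ord_max.
Let f0 : 'I_3 := @Ordinal 3 0 isT.
Let f1 : 'I_3 := @Ordinal 3 1 isT.
Let fd : 'I_3 := @Ordinal 3 2 isT.

Fixpoint look_for (i : 'I_2) (c : 'I_3) (w : word S) : @prog S 2 3 :=
  if w is a :: w' then
    cond (fun b _ => b i == Some a)
      (seqp (adv i) (seqp (look_for i c w') (basic (Move i MLeft)))) stop
  else basic (Inc c).

Definition appears w (p : sequence S) h := w == mkseq (fun l => p (h + l)) (size w).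

Lemma exec_look_for (x : @inputs S 2) i c w p s : (forall m, x i m = Some (p m)) ->
  exec x (look_for i c w) s [::] (if appears w p (hd s i) then setc s c (ct s c).+1 else s).
Proof.
move=> xi; elim: w s => [|a w IH] s; first by rewrite /appears; apply: exec_basic.
have -> : appears (a :: w) p (hd s i) = (p (hd s i) == a) && appears w p (hd s i).+1.
  rewrite /appears /mkseq /= addn0 (iotaDl 1 0) -map_comp eqseq_cons [a == _]eq_sym.
  by congr (_ && (_ == _)); apply: eq_map => l /=; rewrite add1n addSnnS.
apply: exec_cond; rewrite /holds /look xi (inj_eq Some_inj).
case: eqP => _ /=; last exact: exec_stop.
pose s1 := seth s i (hd s i).+1.
rewrite -[[::]]/([::] ++ ([::] ++ [::])).
apply: exec_seq; first exact: (exec_basic _ _ s : exec x (adv i) s [::] s1).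
apply: exec_seq (IH s1) _; rewrite /s1 /= eqxx.
have back v : do_op (Move i MLeft : @op S 2 3) (setc s1 c v) = setc s c v.
  by congr Store; apply/funext => l /=; rewrite !eqxx; case: eqP => // ->.
have back0 : do_op (Move i MLeft : @op S 2 3) s1 = s.
  by apply: storeP => //; apply/funext => l /=; rewrite !eqxx; case: eqP => // ->.
case: (appears _ _ _).
  by have := exec_basic x (Move i MLeft) (setc s1 c (ct s c).+1); rewrite back.
by have := exec_basic x (Move i MLeft) s1; rewrite back0.
Qed.

Let pat : word S := enclose [::].

Definition up (c : 'I_3) : @test S 2 3 := fun _ z => ~~ z c.

Definition decide_pair : @prog S 2 3 :=
  cond (up fd) (outs [:: one; one])
    (cond (up f0) (seqp (outs [:: one; zero]) (basic (Inc fd)))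
      (cond (up f1) (seqp (outs [:: zero; one]) (basic (Inc fd)))
        (outs [:: one; one]))).

Definition search_round : @prog S 2 3 :=
  seqp (look_for i0 f0 pat) (seqp (look_for i1 f1 pat) (seqp decide_pair
    (seqp (seqp (basic (Dec f0)) (basic (Dec f1))) (seqp (adv i0) (adv i1))))).

Section Search.
Variables (p q : sequence S).

Let found N := appears pat p N || appears pat q N.
Let before N := has found (iota 0 N).

(* The zero that completes an enclosed empty word goes to the sequence of the
   set that is to be the whole space. *)
Let left_letter N := if [&& ~~ before N, ~~ appears pat p N & appears pat q N]
  then zero else one.
Let right_letter N := if ~~ before N && appears pat p N then zero else one.

(* Two ones come first, as an enclosed word must begin with them. *)
Let shifted (f : nat -> S) (m : nat) := if m is m'.+2 then f m' else one.

Let st N : @store 2 3 := Store (fun=> N) (fun l => if l == fd then nat_of_bool (before N) else 0).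

Lemma exec_search_round N :
  exec (tnth [tuple tape_of (p : Y S Sequences); tape_of (q : Y S Sequences)])
    search_round (st N) [:: left_letter N; right_letter N] (st N.+1).
Proof.
set x := tnth _; have x0 m : x i0 m = Some (p m) by rewrite /x (tnth_nth (tape_of (p : Y S Sequences))).
have x1 m : x i1 m = Some (q m) by rewrite /x (tnth_nth (tape_of (p : Y S Sequences))).
pose a := appears pat p N; pose b := appears pat q N; pose d := before N.
pose s1 := if a then setc (st N) f0 1 else st N.
pose s2 := if b then setc s1 f1 1 else s1.
pose s3 := setc s2 fd (d || a || b).
have s2E : s2 = Store (fun=> N) (fun l => if l == fd then nat_of_bool d else
    if l == f0 then nat_of_bool a else if l == f1 then nat_of_bool b else 0).
  rewrite /s2 /s1; case: (a); case: (b); apply: storeP => //= l; rewrite -/d;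
  by do 3 (case: eqP => [?|_]; try subst l) => //=.
have E1 : exec x (look_for i0 f0 pat) (st N) [::] s1.
  exact: (exec_look_for f0 pat (st N) x0).
have E2 : exec x (look_for i1 f1 pat) s1 [::] s2.
  have := exec_look_for f1 pat s1 x1; rewrite /s2 /b.
  have -> : hd s1 i1 = N by rewrite /s1; case: (a).
  by have -> : ct s1 f1 = 0 by rewrite /s1; case: (a).
have E3 : exec x decide_pair s2 [:: left_letter N; right_letter N] s3.
  rewrite /left_letter /right_letter -/a -/b -/d /s3 s2E.
  have up_d : holds x s2 (up fd) = d by rewrite /holds /zeros /= s2E /=; case: (d).
  have up_0 : holds x s2 (up f0) = a by rewrite /holds /zeros /= s2E /=; case: (a).
  have up_1 : holds x s2 (up f1) = b by rewrite /holds /zeros /= s2E /=; case: (b).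
  have inc : d = false -> exec x (basic (Inc fd)) s2 [::] (setc s2 fd 1).
    have ctd : ct s2 fd = d by rewrite s2E.
    by move=> d0; have := exec_basic x (Inc fd) s2; rewrite /= ctd d0.
  have nop v : nat_of_bool d = v -> setc s2 fd v = s2.
    by move=> dv; apply: setc_id; rewrite s2E.
  rewrite -s2E; apply: exec_cond; rewrite up_d; case Ed: (d) => /=.
    by rewrite nop ?Ed //; apply: (exec_outs x [:: one; one]).
  apply: exec_cond; rewrite up_0; case Ea: (a) => /=.
    by rewrite -[_ :: _]cats0; apply: exec_seq (exec_outs x [:: one; zero] _) (inc Ed).
  apply: exec_cond; rewrite up_1; case Eb: (b) => /=.
    by rewrite -[_ :: _]cats0; apply: exec_seq (exec_outs x [:: zero; one] _) (inc Ed).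
  by rewrite nop ?Ed //; apply: (exec_outs x [:: one; one]).
rewrite -[_ :: _]/([::] ++ ([::] ++ ([:: left_letter N; right_letter N] ++
  (([::] ++ [::]) ++ ([::] ++ [::]))))).
apply: exec_seq E1 (exec_seq E2 (exec_seq E3 _)).
pose s4 := do_op (Dec f1 : @op S 2 3) (do_op (Dec f0 : @op S 2 3) s3).
apply: (@exec_seq _ _ _ x _ _ _ _ s4).
  by apply: exec_seq; apply: exec_basic.
apply: exec_seq; first exact: exec_basic.
suff -> : st N.+1 = do_op (Move i1 MRight : @op S 2 3) (do_op (Move i0 MRight : @op S 2 3) s4).
  exact: exec_basic.
have -> : st N.+1 = Store (fun=> N.+1) (fun l => if l == fd then nat_of_bool (d || a || b) else 0).
  apply: storeP => // l; rewrite /= {1}/before -[in iota _ N.+1]addn1 iotaD has_cat.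
  by rewrite -/(before N) -/d /= orbF add0n /found -/a -/b orbA.
rewrite /s4 /s3 s2E; apply: storeP.
  by apply/funext => -[[|[|]]].
by move=> [[|[|[|]]] lt] //=; case: (a); case: (b).
Qed.

Lemma pairing_letters (P Q : sequence S) N :
  flatten (mkseq (fun m => [:: P m; Q m]) N) = mkseq (pairing (P : Y S Sequences) Q) N.*2.
Proof.
elim: N => // N IH; rewrite mkseqS flatten_rcons IH doubleS !mkseqS -!cats1 -catA /=.
by rewrite odd_double /= doubleK uphalf_double.
Qed.

Let P : sequence S := shifted left_letter.
Let Q : sequence S := shifted right_letter.

Lemma result_search :
  result (compile (seqp (outs [:: one; one; one; one]) (forever search_round)))
    (tnth [tuple tape_of (p : Y S Sequences); tape_of (q : Y S Sequences)])
    (pairing (P : Y S Sequences) Q).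
Proof.
apply: (result_forever (s := st) (o := fun N => [:: left_letter N; right_letter N])) => //.
- have -> : st 0 = store0 by apply: storeP => //= l; case: eqP.
  exact: exec_outs.
- exact: exec_search_round.
move=> N; suff -> : [:: one; one; one; one] ++
    flatten (mkseq (fun N => [:: left_letter N; right_letter N]) N) =
    mkseq (pairing (P : Y S Sequences) Q) N.+2.*2 by exact: initial_mkseq.
by rewrite -pairing_letters /mkseq /= (iotaDl 2 0) -map_comp.
Qed.

(** If the empty word is found in [p], the closed set named by [p] is empty; it
    is then enclosed in the empty set, and the other one in the whole space. *)
Lemma first_found N : found N -> (forall M, M < N -> ~~ found M) ->
  if appears pat p N then lists P set0 /\ lists Q [set [::]]
  else lists P [set [::]] /\ lists Q set0.
Proof.
move=> fN minN; have bN : before N = false.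
  by apply/negbTE/hasPn => M; rewrite mem_iota => /andP[_ /minN].
have bM M : N < M -> before M by move=> lt; apply/hasP; exists N; rewrite ?mem_iota.
have lE M : left_letter M = if (M == N) && ~~ appears pat p N then zero else one.
  rewrite /left_letter; case: (ltngtP M N) => [lt|/bM ->|->] //=.
    by have := minN _ lt; rewrite negb_or => /andP[_ /negbTE ->]; rewrite !andbF.
  by move: fN; rewrite bN /found; case: (appears pat p N) => //= ->.
have rE M : right_letter M = if (M == N) && appears pat p N then zero else one.
  rewrite /right_letter; case: (ltngtP M N) => [lt|/bM ->|->] //=; last by rewrite bN.
  by have := minN _ lt; rewrite negb_or => /andP[/negbTE -> _]; rewrite andbF.
case: ifP => a; rewrite a in lE rE; split.
- by apply: lists_ones => -[|[|m]] //=; rewrite lE andbF.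
- by apply: (@lists_one_zero _ N) => -[|[|m]] //=; rewrite rE andbT.
- by apply: (@lists_one_zero _ N) => -[|[|m]] //=; rewrite lE andbT.
- by apply: lists_ones => -[|[|m]] //=; rewrite rE andbF.
Qed.

Lemma search_nil : occurs [::] p \/ occurs [::] q ->
  exists P' Q' : sequence S,
  result (compile (seqp (outs [:: one; one; one; one]) (forever search_round)))
    (tnth [tuple tape_of (p : Y S Sequences); tape_of (q : Y S Sequences)])
    (pairing (P' : Y S Sequences) Q') /\
  (occurs [::] p /\ lists P' set0 /\ lists Q' [set [::]] \/
   occurs [::] q /\ lists P' [set [::]] /\ lists Q' set0).
Proof.
move=> H; have ex : exists N, found N.
  by case: H => -[N /eqP H]; exists N; rewrite /found /appears H ?orbT.
case: (ex_minnP ex) => N fN minN.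
exists P, Q; split; first exact: result_search.
have minN' M : M < N -> ~~ found M by apply: contraTN => /minN; rewrite -leqNgt.
move: (fN) (first_found fN minN'); rewrite /found; case: ifP => [/eqP a _ H'|_ /= /eqP b H'].
  by left; split=> //; exists N.
by right; split=> //; exists N.
Qed.

End Search.

Lemma theta_lists (X : ctspace S) p A U : (forall u, nu X u) -> lists p A ->
  U = \bigcup_(u in A) base_set (@nu S X) u -> theta p U.
Proof.
move=> domT pA ->; split=> [u _|]; first exact: domT.
by congr bigcup; apply/funext => u; apply/propext; split=> /(occurs_lists u pA).
Qed.

(** Two disjoint closed sets do not both contain the point whose only
    neighbourhood is the whole space. So in one of the two names of complements
    there is the empty word, the only word to name the whole space. *)
Lemma sierpinski_CT4 : CT4 sierpinski.
Proof.
apply: (multi_computable_result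
  (M := compile (seqp (outs [:: one; one; one; one]) (forever search_round)))).
move=> p q A A' [_ pA] [_ qA'] [[U0 V0] [_ _ UV AU A'V]].
move: UV AU A'V; rewrite /fst /snd => UV AU A'V.
have nilE r (B : set bool) : ~` B = \bigcup_(u in [set u | occurs u r])
    base_set (@nu S sierpinski) u -> ~ B false <-> occurs [::] r.
  move=> E; rewrite -[~ B false]/((~` B) false) E; split=> [[u /= ur]|r0].
    by rewrite /base_set /= /sierpinski_set /= orbF => /nilP u0; rewrite -u0.
  by exists [::].
have whole r (B : set bool) : ~` B = \bigcup_(u in [set u | occurs u r])
    base_set (@nu S sierpinski) u -> occurs [::] r -> B = set0.
  by move=> E r0; rewrite -[B]setCK E -[RHS]setCT; congr (~` _); apply/seteqP; split=> // x _; exists [::].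
have [|P [Q [R PQ]]] := @search_nil p q.
  have [/AU U0f|/(nilE _ _ pA)] := pselect (A false); last by left.
  right; apply/(nilE _ _ qA') => /A'V V0f.
  by have : (U0 `&` V0) false by []; rewrite UV.
have open0 : open (set0 : set sierpinski) by exact: open0.
have openT : open (setT : set sierpinski) by exact: openT.
have th0 r : lists r set0 -> theta r (set0 : set sierpinski).
  by move=> r0; apply: (theta_lists _ r0); [done|rewrite bigcup_set0].
have thT r : lists r [set [::]] -> theta r (setT : set sierpinski).
  move=> r0; apply: (theta_lists _ r0); first by [].
  by rewrite bigcup_set1; apply/seteqP.
exists (pairing (P : Y S Sequences) Q) => //.
case: PQ => [[/(whole _ _ pA) A0 [/th0 HP /thT HQ]]|[/(whole _ _ qA') A0 [/thT HP /th0 HQ]]].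
  exists (set0, setT); first by exists P, Q.
  by split=> //=; rewrite ?set0I // A0.
exists (setT, set0); first by exists P, Q.
by split=> //=; rewrite ?setI0 // A0.
Qed.

End Sierpinski.

(** * Combs: columns with limits, and a hub *)

Section Comb.
Context {S : alphabet}.
Local Notation zero := (a0 S).
Local Notation one := (a1 S).

(** The hub is [None], and [Some (n, Some j)] is the [j]-th of the points that
    converge to [Some (n, None)], the limit of the column [n]. *)
Definition point := option (nat * option nat).

Variant subbasic := Hub of nat | Tail of nat & nat | Puncture of nat.

Definition index_code : Type := (nat + nat * nat + nat)%type.

Definition index_of (m : nat) : option subbasic :=
  omap (fun c : index_code => match c with
    | inl (inl k) => Hub k | inl (inr nj) => Tail nj.1 nj.2 | inr e => Puncture e end)
    (unpickle m).

Definition code_of (i : subbasic) : nat := pickle (match i with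
  | Hub k => inl (inl k) | Tail n j => inl (inr (n, j)) | Puncture e => inr e end : index_code).

Lemma code_ofK i : index_of (code_of i) = Some i.
Proof. by rewrite /index_of pickleK; case: i. Qed.

Section Sets.
Variables (K : nat -> nat) (E : nat -> set nat).

Definition pos (i : subbasic) : set point := fun p =>
  match i, p with
  | Hub _, None => True
  | Hub k, Some (n, _) => k < K n
  | Tail _ _, None => False
  | Tail n j, Some (n', None) => n' = n
  | Tail n j, Some (n', Some l) => n' = n /\ j <= l
  | Puncture e, Some (n, None) => ~ E e n
  | Puncture _, _ => True
  end.

(** For [Hub k] and [Tail n j], whose sets are clopen, this is the complement
    without the hub: among the names of neighbourhoods of the hub, the complement
    of a tail would be one whose closure omits the limit whatever [K] is. *)
Definition neg (i : subbasic) : set point := fun p =>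
  match i with
  | Puncture _ => False
  | _ => p <> None /\ ~ pos i p
  end.

Lemma pos_neg i p : pos i p -> neg i p -> False.
Proof. by case: i => [k|n j|e] //= H []. Qed.

(** The numbering has the period four in order that any two consecutive numbers
    belong to disjoint sets and that each set occurs before and after its
    counterpart: prefixing a one then yields all pairs needed for [SCT2]. *)
Definition comb_set (m : nat) : set point :=
  if index_of (m %/ 4) is Some i then
    match m %% 4 with 0 | 2 => pos i | 1 => neg i | _ => set0 end
  else set0.

Lemma comb_setE i r : r < 4 -> comb_set (code_of i * 4 + r) =
  match r with 0 | 2 => pos i | 1 => neg i | _ => set0 end.
Proof.
by move=> r4; rewrite /comb_set divnMDl // modnMDl modn_small // divn_small // addn0 code_ofK.
Qed.

Lemma comb_set_disjoint m p : comb_set m p -> comb_set m.+1 p -> False.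
Proof.
rewrite (divn_eq m 4); move: (m %/ 4) (ltn_pmod m (isT : 0 < 4)) => q.
rewrite /comb_set; case: (m %% 4) => [|[|[|[|r]]]] // _; rewrite -?addnS;
  rewrite !divnMDl // !modnMDl !addn0 //; case: (index_of q) => // i.
- exact: pos_neg.
- by move=> H H'; apply: (pos_neg H' H).
Qed.

Lemma comb_separated p q : p <> q ->
  exists i, (pos i p /\ neg i q) \/ (neg i p /\ pos i q).
Proof.
have hub n r q' : (p = None /\ q = Some (n, r)) \/ (q = None /\ p = Some (n, r)) -> q' = q ->
    exists i, (pos i p /\ neg i q) \/ (neg i p /\ pos i q).
  by case=> -[-> ->] _; exists (Hub (K n)); [left|right]; split=> //=; split=> //; rewrite ltnn.
have sym : (exists n j, (pos (Tail n j) p /\ neg (Tail n j) q) \/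
    (neg (Tail n j) p /\ pos (Tail n j) q)) ->
    exists i, (pos i p /\ neg i q) \/ (neg i p /\ pos i q).
  by move=> [n [j H]]; exists (Tail n j).
case: p q hub sym => [[n r]|] [[n' r']|] hub sym // ne;
  [|by apply: hub; [right|]|by apply: hub; [left|]].
apply: sym; have [nn|nn] := eqVneq n n'; last first.
  have nn' : n' <> n by move=> nE; rewrite nE eqxx in nn.
  exists n, 0; left; split; first by case: (r).
  by split=> //; case: (r') => [l'|] //= [].
rewrite -{}nn in ne *; case: r r' ne {hub} => [l|] [l'|] ne /=.
- case: (ltngtP l l') => [lt|lt|ll]; last by rewrite ll in ne.
    by exists n, l'; right; split=> //; split=> // -[_]; rewrite leqNgt lt.
  by exists n, l; left; split=> //; split=> // -[_]; rewrite leqNgt lt.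
- by exists n, l.+1; right; split=> //; split=> // -[_]; rewrite ltnn.
- by exists n, l'.+1; left; split=> //; split=> // -[_]; rewrite ltnn.
- by case: ne.
Qed.

Lemma comb_cover p : exists m, comb_set m p.
Proof.
case: p => [[n r]|].
  exists (code_of (Tail n 0) * 4 + 0); rewrite comb_setE //=.
  by case: r.
by exists (code_of (Hub 0) * 4 + 0); rewrite comb_setE.
Qed.

Lemma comb_T0 p q : p <> q ->
  exists m, (comb_set m p /\ ~ comb_set m q) \/ (~ comb_set m p /\ comb_set m q).
Proof.
move=> /comb_separated[i H]; exists (code_of i * 4 + 0); rewrite comb_setE //.
case: H => -[Hp Hq]; [left|right]; split=> // H; [exact: pos_neg H Hq|exact: pos_neg H Hp].
Qed.

Definition comb : ctspace S := numbered comb_cover comb_T0.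

Lemma comb_SCT2 : SCT2 comb.
Proof.
pose i0 : 'I_2 := ord0; pose i1 : 'I_2 := ord_max.
have := @re_concat S 2 i1 [:: inl [:: one]; inr i0]; set H := [set t | _] => reH.
have HE u v : H [tuple u; v] <-> v = one :: u by rewrite /H /= cats0.
exists H; split=> //; first exact: reH.
- move=> p q /comb_separated[i].
  have named_ones r : base_set (@nu S comb) (nseq (code_of i * 4 + r) one) =
      comb_set (code_of i * 4 + r) by exact: of_pieces_ones.
  case=> -[Hp Hq]; [pose r := 0|pose r := 1];
    exists (nseq (code_of i * 4 + r) one), (nseq (code_of i * 4 + r.+1) one);
    by rewrite !named_ones !comb_setE //; split=> //; apply/HE; rewrite addnS.
- move=> u v /HE ->; apply/seteqP; split=> // p [[_ pu] [_ pv]].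
  have : head 0 (pieces u) \in pieces u.
    by case: (u) => [|a w] /=; [|case: ifP => _ /=]; rewrite inE eqxx.
  move=> /pu/comb_set_disjoint; apply; apply: pv.
  by rewrite pieces_cons_one inE eqxx.
Qed.

Lemma eventually_all (T : eqType) (s : seq T) (Q : T -> nat -> Prop) :
  {in s, forall m, exists k0, forall k, k0 <= k -> Q m k} ->
  exists k0, forall k, k0 <= k -> {in s, forall m, Q m k}.
Proof.
elim: s => [|m s IH] H; first by exists 0.
have [k0 H0] := H m (mem_head _ _).
have [m' ms'|k1 H1] := IH; first by apply: H; rewrite inE ms' orbT.
exists (maxn k0 k1) => k; rewrite geq_max => /andP[le0 le1] m'.
by rewrite inE => /orP[/eqP ->|]; [exact: H0|exact: H1].
Qed.

Lemma comb_setP m p : comb_set m p -> exists i, [/\ index_of (m %/ 4) = Some i,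
  pos i p & pos i = comb_set m] \/ (neg i p /\ neg i = comb_set m).
Proof.
rewrite /comb_set; case E': (index_of _) => [i|] //.
by case: (m %% 4) => [|[|[|r]]] // H; exists i; [left|right|left].
Qed.

Definition bound (m : nat) : nat := if index_of (m %/ 4) is Some (Hub k) then k.+1 else 0.

(** A neighbourhood of the hub loses points of a column only by the sets [Hub k],
    and then the whole column; punctures remove limits and nothing else. This is
    why the limits removed come back with the closure. *)
Lemma hub_named (u : word S) n j : of_pieces comb_set u None ->
  {in pieces u, forall m, bound m <= K n} -> of_pieces comb_set u (Some (n, Some j)).
Proof.
move=> [bu Hu] Hb; split=> // m mu; have /comb_setP[i [[Ei pi <-]|[ni _]]] := Hu m mu.
  by have := Hb m mu; rewrite /bound Ei; case: i {Ei} pi.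
by case: i ni => [k|n' j'|e] //= [].
Qed.

Lemma limit_named (u : word S) n : of_pieces comb_set u (Some (n, None)) ->
  exists j0, forall j, j0 <= j -> of_pieces comb_set u (Some (n, Some j)).
Proof.
move=> [bu Hu].
have [|j0 Hj0] := @eventually_all _ (pieces u) (fun m j => comb_set m (Some (n, Some j))).
  move=> m mu; have /comb_setP[i [[_ pi <-]|[ni <-]]] := Hu m mu.
    by case: i pi => [k|n' j'|e] /= pi; [exists 0|exists j'|exists 0].
  by case: i ni => [k|n' j'|e] //= [_ ni]; exists 0 => j _; split=> // -[].
by exists j0 => j le; split=> // m mu; exact: Hj0.
Qed.

End Sets.

(** With all limits removed, the punctured space is a neighbourhood of the hub,
    but any neighbourhood of the hub contains whole columns but for the limits. *)
Lemma comb_notT3 : ~ T3 (comb (fun n => n) (fun=> setT)).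
Proof.
set X := comb _ _ => t3; pose A : set X := [set p | exists n, p = Some (n, None)].
have Acl : closed A.
  rewrite -openC; suff -> : ~` A = (comb_set id (fun=> setT) (code_of (Puncture 0) * 4 + 0) : set X).
    by rewrite -(@of_pieces_ones S); exact: open_named.
  rewrite comb_setE //; apply/seteqP; split=> -[[n [j|]]|] //=.
  - by move=> H _; apply: H; exists n.
  - by move=> _ [].
  - by move=> _ [].
have [|U [V [Uop Vop UV Ux AV]]] := t3 (None : X) A Acl; first by move=> [].
have [u [ux uU]] := Uop _ Ux; pose n := \max_(m <- pieces u) bound m.
have Vy : V (Some (n, None)) by apply: AV; exists n.
have [v [vy vV]] := Vop _ Vy; have [j Hj] := limit_named vy.
have : (U `&` V) (Some (n, Some j)).
  split; last by apply: vV; apply: Hj.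
  by apply: uU; apply: hub_named ux _ => m mu; apply: leq_bigmax_seq.
by rewrite UV.
Qed.

Section Punctures.
Variable K : nat -> nat.
Let E (n : nat) : set nat := [set n].
Let X : ctspace S := comb K E.

(** A basis such that of two sets that meet one contains the centre of the
    other, as for the balls of an ultrametric; [T4] follows from this alone. *)
Definition ball (p : point) (k : nat) : set X :=
  match p with
  | None => pos K E (Hub k)
  | Some (n, None) => pos K E (Tail n k)
  | Some (n, Some j) => [set p]
  end.

Let ball_center p k : ball p k p.
Proof. by case: p => [[n [j|]]|]. Qed.

Lemma ball_nested p k p' k' q : ball p k q -> ball p' k' q -> ball p k p' \/ ball p' k' p.
Proof.
case: p p' q => [[n [j|]]|] [[n' [j'|]]|] [[m [l|]]|] //=; try by [left|right];
  try by move=> -> ->; left.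
- by move=> [-> ->] [-> kl]; right.
- by move=> [-> _] lt; right.
- by move=> [-> kl] [<- <-]; left.
- by move=> [-> _] [-> _]; left.
- by move=> [-> _] lt; right.
- by move=> -> lt; right.
- by move=> lt [<- _]; left.
- by move=> lt [<- _]; left.
- by move=> lt <-; left.
Qed.

Let open_comb_set m : open (comb_set K E m : set X).
Proof. by rewrite -(@of_pieces_ones S); exact: open_named. Qed.

Let open_pos i : open (pos K E i : set X).
Proof. by have := @open_comb_set (code_of i * 4 + 0); rewrite comb_setE. Qed.

Let open_neg i : open (neg K E i : set X).
Proof. by have := @open_comb_set (code_of i * 4 + 1); rewrite comb_setE. Qed.

Lemma open_ball p k : open (ball p k).
Proof.
case: p => [[n [j|]]|]; [|exact: open_pos..].
suff -> : ball (Some (n, Some j)) k = (pos K E (Tail n j) : set X) `&` neg K E (Tail n j.+1).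
  by apply: openI; [exact: open_pos|exact: open_neg].
apply/seteqP; split=> [p ->|[[n' [l|]]|] [] //=]; first by split=> //=; split=> // -[_]; rewrite ltnn.
  move=> [-> jl] [_ nl]; congr (Some (_, Some _)); apply/eqP; rewrite eqn_leq jl andbT leqNgt.
  by apply/negP => lt; apply: nl.
by move=> -> [_ []].
Qed.

Lemma ball_basis (A : set X) p : open A -> A p -> exists k, ball p k `<=` A.
Proof.
move=> Aop Ap; have [u [[bu up] uA]] := Aop _ Ap.
have [|k0 Hk0] := @eventually_all _ (pieces u) (fun m k => ball p k `<=` comb_set K E m).
  move=> m /up /comb_setP[i [[_ + <-]|[+ <-]]].
    case: p {Ap up} => [[n [j|]]|]; case: i => [k'|n' j'|e] //=.
    + by move=> lt; exists 0 => k _ q ->.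
    + by move=> H; exists 0 => k _ q ->.
    + by exists 0 => k _ q ->.
    + by move=> lt; exists 0 => k _ [[m' [l|]]|] //=; [move=> [-> _]|move=> ->].
    + move=> ->; exists j' => k le [[m' [l|]]|] //= [-> le']; split=> //.
      exact: leq_trans le'.
    + by move=> H; exists 0 => k _ [[m' [l|]]|] //= ->.
    + by move=> _; exists k' => k le [[m' [l|]]|] //=; apply: leq_ltn_trans.
    + move=> _; exists (K e) => k le [[m' [l|]]|] //= lt E'.
      by move: lt; rewrite E' ltnNge le.
  case: p {Ap up} => [[n [j|]]|]; case: i => [k'|n' j'|e] //=; try by case.
  + by move=> H; exists 0 => k _ q ->.
  + by move=> H; exists 0 => k _ q ->.
  + by move=> [_ H]; exists 0 => k _ [[m' [l|]]|] //=; [move=> [-> _]|move=> ->].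
  + move=> [_ H]; exists 0 => k _ [[m' [l|]]|] //=.
      by move=> [-> _]; split=> // -[/H].
    by move=> ->; split=> // /H.
by exists k0 => q qb; apply: uA; split=> // m mu; exact: Hk0 qb.
Qed.

Lemma comb_T4 : T4 X.
Proof.
move=> A A' Acl A'cl AA'.
pose N (B B' : set X) := \bigcup_(pk in [set pk : point * nat | B pk.1 /\
  ball pk.1 pk.2 `&` B' = set0]) ball pk.1 pk.2.
have Nop B B' : open (N B B') by apply: bigcup_open => -[p k] _; exact: open_ball.
have NB B B' : closed B' -> B `&` B' = set0 -> B `<=` N B B'.
  move=> B'cl BB' p Bp; have [|k kB'] := @ball_basis (~` B') p (closed_openC B'cl).
    by move=> B'p; have : (B `&` B') p by []; rewrite BB'.
  by exists (p, k) => /=; [split=> //; apply/disjoints_subset|exact: ball_center].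
exists (N A A'), (N A' A); split=> //; [|exact: NB|by apply: NB; rewrite // setIC].
apply/seteqP; split=> // q [[[p k] /= [Ap pA'] qp] [[p' k'] /= [A'p' p'A] qp']].
have [H|H] := ball_nested qp qp'.
  by have : (ball p k `&` A') p' by []; rewrite pA'.
by have : (ball p' k' `&` A) p by []; rewrite p'A.
Qed.

End Punctures.

(** The names of the hub are the same for all [K]. So the answer of the [n]-th
    machine to the [n]-th puncture and a fixed name of the hub is known before
    [K n] is chosen, and [K n] is made larger than all numbers in the answer. *)
Lemma comb_notWCT3 : exists K, ~ WCT3 (comb K (fun e => [set e])).
Proof.
pose E (e : nat) : set nat := [set e].
have [g Hg] := @machine_enumeration S 2.
have [px Hpx] := lists_exist [set u : word S | of_pieces (comb_set (fun=> 0) E) u None].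
pose W e : word S := nseq (code_of (Puncture e) * 4 + 0) one.
pose answer e : word S := if pselect (exists w : Y S Words,
  result (g e) (tnth [tuple tape_of (px : Y S Sequences); tape_of (W e : Y S Words)]) w)
  is left H then projT1 (cid H) else [::].
pose K e := \max_(m <- pieces (answer e)) bound m.
exists K; set X := comb K E.
have Wset e : base_set (@nu S X) (W e) = pos K E (Puncture e).
  by rewrite /base_set /= of_pieces_ones comb_setE.
have px_hub : @delta S X px (None : X).
  rewrite /delta; suff <- : [set u : word S | of_pieces (comb_set (fun=> 0) E) u None] =
      [set u | base_set (@nu S X) u (None : X)] by [].
  suff H m : comb_set (fun=> 0) E m None <-> comb_set K E m None.
    by apply/seteqP; split=> u [bu Hu]; split=> // m /Hu/H.
  by rewrite /comb_set; case: index_of => [i|] //; case: (m %% 4) => [|[|[|r]]]; case: i.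
move=> [h [[M HM] Hh]]; have [e He] := Hg M.
have [|u hu [U Uu [_ Ux _ UW]]] := Hh px (W e) (None : X) _ px_hub (erefl _).
  pose u : word S := nseq (code_of (Hub (K e)) * 4 + 0) one.
  have uE : of_pieces (comb_set K E) u = pos K E (Hub (K e)).
    by rewrite of_pieces_ones comb_setE.
  exists (of_pieces (comb_set K E) u); split; [by exists u|by rewrite uE|exact: subset_closure|].
  rewrite uE => p clp; suff : pos K E (Puncture e) p by rewrite -(Wset e).
  case: p clp => [[n [j|]]|] //= clp En.
  have [|q [qH qT]] := clp (pos K E (Tail n 0)).
    apply/nbhsP; exists (nseq (code_of (Tail n 0) * 4 + 0) one).
    by rewrite /= of_pieces_ones comb_setE //; split.
  case: q qH qT => [[n' [l|]]|] //=; rewrite En; last by move=> lt E'; rewrite E' ltnn in lt.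
  by move=> lt [E' _]; rewrite E' ltnn in lt.
have /He hu' := (HM px (W e) u).1 hu.
have ansE : answer e = u.
  rewrite /answer; case: pselect => [H|[]]; last by exists u.
  by case: cid => w Hw; exact: (result_unique (kd := Words) Hw hu').
have UE : U = of_pieces (comb_set K E) u by case: Uu.
have cl : closure U (Some (e, None)).
  move=> B /nbhsP[v [vy vB]]; have [j Hj] := limit_named vy.
  exists (Some (e, Some j)); split; last by apply: vB; apply: Hj.
  rewrite UE; apply: hub_named; first by rewrite -UE.
  by move=> m mu; rewrite /K ansE; apply: leq_bigmax_seq.
have : pos K E (Puncture e) (Some (e, None)) by rewrite -(Wset e); exact: UW.
by apply.
Qed.

End Comb.

(** * Pairs of names that may or may not coincide *)

Section Twins.
Context {S : alphabet}.
Local Notation zero := (a0 S).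
Local Notation one := (a1 S).

Section Space.
Variable c : nat -> bool.

Definition twin := {p : nat * bool | p.2 ==> c p.1}.

Lemma twin_subproof m : (odd m && c m./2) ==> c m./2.
Proof. by case: odd => //=; case: c. Qed.

Definition twin_of (m : nat) : twin :=
  exist (fun p : nat * bool => p.2 ==> c p.1) (m./2, odd m && c m./2) (twin_subproof m).

Lemma twin_ofP (p : twin) : twin_of ((sval p).1.*2 + (sval p).2) = p.
Proof.
case: p => [[n b] /= H]; apply: val_inj => /=.
rewrite addnC half_bit_double oddD odd_double addbF.
by case: b H => //= ->.
Qed.

(** The numbers [2n] and [2n+1] are names of the same point unless [c n] holds. *)
Definition twin_set (m : nat) : set twin := [set twin_of m].

Lemma twin_cover p : exists m, twin_set m p.
Proof. by exists ((sval p).1.*2 + (sval p).2); rewrite /twin_set twin_ofP. Qed.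

Lemma twin_T0 p q : p <> q ->
  exists m, (twin_set m p /\ ~ twin_set m q) \/ (~ twin_set m p /\ twin_set m q).
Proof.
move=> ne; exists ((sval p).1.*2 + (sval p).2); left.
by rewrite /twin_set twin_ofP; split=> // E; apply: ne.
Qed.

Definition twins : ctspace S := numbered twin_cover twin_T0.

Lemma twins_D : D twins.
Proof. by apply: openD => m x y -> ->. Qed.

Let i0 : 'I_2 := ord0.
Let i1 : 'I_2 := ord_max.
Let ctr (m : nat) : 'I_6 := inord m.

Let printer_pair : @printer S :=
  Cat (Enclose (For 0 (Lit [:: one]))) (Enclose (For 1 (Lit [:: one]))).

Definition copy_numbers : @prog S 2 6 :=
  seqp (read_number i0 (ctr 0) (ctr 2)) (seqp (read_number i1 (ctr 1) (ctr 2))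
    (print (ctr 3) [:: ctr 0; ctr 1] [:: ctr 4; ctr 5] printer_pair)).

Lemma flatten_ones m : flatten (mkseq (fun=> [:: one]) m) = nseq m one.
Proof. exact: padding_only. Qed.

Lemma result_copy_numbers (p q : sequence S) j m b j' m' b' :
  initial (front j m b) p -> initial (front j' m' b') q ->
  result (compile copy_numbers)
    (tnth [tuple tape_of (p : Y S Sequences); tape_of (q : Y S Sequences)])
    (pairing (nseq m one : Y S Words) (nseq m' one)).
Proof.
move=> Hp Hq; set x := tnth _.
have x0 l : x i0 l = Some (p l) by rewrite /x (tnth_nth (tape_of (p : Y S Sequences))).
have x1 l : x i1 l = Some (q l) by rewrite /x (tnth_nth (tape_of (p : Y S Sequences))).
have ctrE l l' : l < 6 -> l' < 6 -> (ctr l == ctr l') = (l == l').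
  by move=> lt lt'; rewrite -val_eqE /= !inordK.
have [//||||h E0] := exec_read_number x0 (s := store0) (c := ctr 0) (f := ctr 2) _ _ _ _ Hp;
  rewrite ?ctrE //.
set s1 := setc _ _ _ in E0.
have [||||h' E1] := exec_read_number x1 (s := s1) (c := ctr 1) (f := ctr 2) _ _ _ _ Hq;
  rewrite /s1 /= ?ctrE //.
set s2 := setc _ _ _ in E1.
apply: (result_exec (s := s2)).
have := @exec_print S 2 6 x (ctr 3) [:: ctr 0; ctr 1] [:: ctr 4; ctr 5] printer_pair s2.
have -> : text printer_pair [seq ct s2 i | i <- [:: ctr 0; ctr 1]] =
    pairing (nseq m one : Y S Words) (nseq m' one).
  have txt l v : text (Enclose (For l (Lit [:: one]))) v = enclose (nseq (nth 0 v l) one).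
    by rewrite text_Enclose /= flatten_ones.
  by rewrite /printer_pair text_Cat !txt /s2 /s1 /= !ctrE.
move=> E2; change (exec x copy_numbers store0
  ([::] ++ ([::] ++ pairing (nseq m one : Y S Words) (nseq m' one))) s2).
apply: exec_seq E0 (exec_seq E1 (E2 _ _ _ _ _)).
- by rewrite /= !inE !ctrE.
- by [].
- by [].
- by rewrite /s2 /s1 /= !ctrE.
- by move=> l; rewrite !inE => /orP[]/eqP ->; rewrite /s2 /s1 /= !ctrE.
Qed.

(** Every basis set containing a point is the singleton of this point, so any
    numbers read from the names of two different points are those of disjoint
    sets. *)
Lemma twins_CT2 : CT2 twins.
Proof.
apply: (multi_computable_result (M := compile copy_numbers)).
move=> p q x y /delta_front[j [m [b [Hp mx]]]] /delta_front[j' [m' [b' [Hq my]]]].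
move=> [[U0 V0] [_ _ U0x V0y UV0]].
exists (pairing (nseq m one : Y S Words) (nseq m' one)).
  exact: result_copy_numbers Hp Hq.
exists (twin_set m, twin_set m').
  by exists (nseq m one), (nseq m' one); split=> //; rewrite /nu_name /= of_pieces_ones.
have namedm l : exists u, nu twins u = Some (twin_set l).
  by exists (nseq l one); rewrite /= of_pieces_ones.
split=> //=; apply/seteqP; split=> // z [zm zm'].
have xy : x = y by rewrite mx my -zm -zm'.
have : (U0 `&` V0) x by split=> //; rewrite xy.
by rewrite UV0.
Qed.

End Space.

(** Whether the names [2n] and [2n+1] are those of different points is decided
    against the [n]-th recursively enumerable set. *)
Lemma twins_notSCT2 : exists c, ~ SCT2 (twins c).
Proof.
have [g Hg] := @machine_enumeration S 2.
pose A e u v := (exists w : Y S Words,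
  result (g e) (fun i => tape_of (tnth [tuple u; v] i : Y S Words)) w) /\
  [/\ binary u, binary v, {in pieces u, forall m, m = e.*2} &
      {in pieces v, forall m, m = e.*2.+1}].
pose c e := ~~ `[< exists u v, A e u v >].
exists c => -[H [[M HM] _ Hsep Hdisj]]; have [e He] := Hg M.
have HA u v : H [tuple u; v] <-> exists w : Y S Words,
    result (g e) (fun i => tape_of (tnth [tuple u; v] i : Y S Words)) w.
  by rewrite HM; split=> -[w /He Hw]; exists w.
have tE : twin_of c e.*2 = exist _ (e, false) isT by apply: val_inj; rewrite /= doubleK odd_double.
case Ec : (c e).
  have tO : twin_of c e.*2.+1 = exist (fun p : nat * bool => p.2 ==> c p.1) (e, true) Ec.
    by apply: val_inj; rewrite /= uphalf_double odd_double Ec.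
  have [|u [v [Huv [bu ux] [bv vy]]]] := Hsep (twin_of c e.*2) (twin_of c e.*2.+1).
    by rewrite tE tO => -[].
  move: (Ec); rewrite /c => /negP; apply; apply/asboolP; exists u, v; split; first exact/HA.
  split=> // m.
    move=> /ux /(congr1 sval) /=; rewrite doubleK odd_double /= => -[me].
    rewrite -me Ec andbT => /esym om; rewrite -[LHS]odd_double_half om -me.
    by [].
  move=> /vy /(congr1 sval) /=; rewrite uphalf_double odd_double /= Ec => -[me].
  by rewrite -me Ec andbT => /esym om; rewrite -[LHS]odd_double_half om -me.
move: (Ec) => /negbT; rewrite /c negbK => /asboolP[u [v [/HA Huv [bu bv Hu Hv]]]].
have : (base_set (@nu S (twins c)) u `&` base_set (@nu S (twins c)) v) (twin_of c e.*2).
  split; split=> // m; first by move=> /Hu ->.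
  by move=> /Hv ->; apply: val_inj; rewrite /= uphalf_double doubleK odd_double Ec.
by rewrite Hdisj.
Qed.

End Twins.

(** * Names of zero and one *)

Section Intervals.
Context {S : alphabet} (R : realType).
Local Notation zero := (a0 S).
Local Notation one := (a1 S).

(** The word that names [(-1)^s * a / (b + 1)]. *)
Definition rat_word (s : bool) (a b : nat) : word S :=
  (if s then one else zero) :: nseq a one ++ zero :: nseq b one.

Definition rat_value (s : bool) (a b : nat) : rat := ((-1) ^+ s * (a%:R / b.+1%:R))%R.

Definition below_zero (s : bool) (a b : nat) := s && (0 < a).
Definition above_zero (s : bool) (a b : nat) := ~~ s && (0 < a).
Definition below_one (s : bool) (a b : nat) := s || (a <= b).
Definition above_one (s : bool) (a b : nat) := ~~ s && (b.+1 < a).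

Let pos_inv b : (0 < (b.+1%:R : rat)^-1)%R.
Proof. by rewrite invr_gt0 ltr0n. Qed.

Let negative_value a b : rat_value true a b = (- (a%:R / b.+1%:R))%R.
Proof. by rewrite /rat_value expr1 mulN1r. Qed.

Let positive_value a b : rat_value false a b = (a%:R / b.+1%:R)%R.
Proof. by rewrite /rat_value expr0 mul1r. Qed.

Let value_ge0 a b : (0 <= (a%:R / b.+1%:R : rat))%R.
Proof. by rewrite divr_ge0 ?ler0n. Qed.

Lemma rat_value_lt0 s a b : (rat_value s a b < 0)%R = below_zero s a b.
Proof.
case: s; rewrite ?negative_value ?positive_value /below_zero /=.
  by rewrite oppr_lt0 pmulr_lgt0 // ltr0n.
by apply/negbTE; rewrite -leNgt.
Qed.

Lemma rat_value_gt0 s a b : (0 < rat_value s a b)%R = above_zero s a b.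
Proof.
case: s; rewrite ?negative_value ?positive_value /above_zero /=.
  by apply/negbTE; rewrite -leNgt oppr_le0.
by rewrite pmulr_lgt0 // ltr0n.
Qed.

Lemma rat_value_lt1 s a b : (rat_value s a b < 1)%R = below_one s a b.
Proof.
case: s; rewrite ?negative_value ?positive_value /below_one /=.
  by rewrite (le_lt_trans _ ltr01) // oppr_le0.
by rewrite ltr_pdivrMr ?ltr0n // mul1r ltr_nat ltnS.
Qed.

Lemma rat_value_gt1 s a b : (1 < rat_value s a b)%R = above_one s a b.
Proof.
case: s; rewrite ?negative_value ?positive_value /above_one /=.
  by apply/negbTE; rewrite -leNgt (le_trans _ ler01) // oppr_le0.
by rewrite ltr_pdivlMr ?ltr0n // mul1r ltr_nat.
Qed.

(** These are the interval names of zero and of one, freed from the rationals. *)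
Definition unit_intervals (b : bool) : set (word S) := [set w |
  exists s a d s' a' d', w = pairing (rat_word s a d : Y S Words) (rat_word s' a' d') /\
    if b then below_one s a d && above_one s' a' d'
    else below_zero s a d && above_zero s' a' d'].

Lemma unit_intervalsE (b : bool) :
  [set w | exists2 J : set R, interval_name w J & J b%:R%R] = unit_intervals b.
Proof.
have H q r : (q < b%:R < r)%R = (ratr q < (b%:R : R) < ratr r)%R.
  by rewrite -(ratr_nat R) !ltr_rat.
apply/seteqP; split=> w /=.
  move=> [J [u [v [q [r [-> [s [a [d [-> ->]]]] [s' [a' [d' [-> ->]]]] ->]]]]]].
  rewrite /= in_itv /= -H -!/(rat_value _ _ _) => /andP[qb br].
  exists s, a, d, s', a', d'; split=> //.
  by case: (b) qb br => /=; rewrite ?rat_value_lt0 ?rat_value_gt0 ?rat_value_lt1 ?rat_value_gt1 => -> ->.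
move=> [s [a [d [s' [a' [d' [-> Hb]]]]]]].
exists `]ratr (rat_value s a d), ratr (rat_value s' a' d')[%classic.
  exists (rat_word s a d), (rat_word s' a' d'), (rat_value s a d), (rat_value s' a' d').
  by split=> //; [exists s, a, d|exists s', a', d'].
rewrite /= in_itv /= -H.
by case: (b) Hb => /= /andP[]; rewrite -?rat_value_lt0 -?rat_value_gt0 -?rat_value_lt1 -?rat_value_gt1 => -> ->.
Qed.

Definition ones_printer (l : nat) : printer := For l (Lit [:: one]).

Definition rat_printer (s : bool) (e e' : @printer S) : printer :=
  Cat (Lit [:: if s then one else zero]) (Cat e (Cat (Lit [:: zero]) e')).

Definition interval_printer (e e' : @printer S) : printer :=
  Block (Enclose (Cat (Enclose e) (Enclose e'))).

(** The four loop variables [a], [b], [c], [d], of which the last has the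
    number 0, run through all numbers below the bound, and the numerators and
    denominators are sums of them, so that no comparison is made: an interval around one has the endpoints
    [- a / (b + 1)] or [a / (a + b + 1)] and [(c + d + 2) / (c + 1)]. *)
Definition intervals_printer (b : bool) : printer :=
  let one_more e := Cat (Lit [:: one]) e in
  if b then
    let upper := rat_printer false
      (Cat (ones_printer 1) (Cat (Lit [:: one; one]) (ones_printer 0))) (ones_printer 1) in
    Cat (interval_printer (rat_printer true (ones_printer 3) (ones_printer 2)) upper)
        (interval_printer (rat_printer false (ones_printer 3)
           (Cat (ones_printer 3) (ones_printer 2))) upper)
  else interval_printer
    (rat_printer true (one_more (ones_printer 3)) (ones_printer 2))
    (rat_printer false (one_more (ones_printer 1)) (ones_printer 0)).

(** The beginning of a name of zero or of one, its length being governed by the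
    number with index [l]. *)
Definition value_printer (l : nat) (b : bool) : printer :=
  For l (Cat (Lit [:: one]) (For 0 (For 1 (For 2 (For 3 (intervals_printer b)))))).

Definition value_items (b : bool) (N : nat) : seq (word S) := items (value_printer 0 b) [:: N].
Definition value_prefix (b : bool) (N : nat) : word S := flatten (value_items b N).

Lemma text_value_printer l b v : text (value_printer l b) v = value_prefix b (nth 0 v l).
Proof. by rewrite /value_prefix /value_items flatten_items; case: b. Qed.

Lemma text_ones l v : text (ones_printer l) v = nseq (nth 0 v l) one.
Proof. by rewrite /ones_printer /= padding_only. Qed.

Lemma text_rat s e e' v a d : text e v = nseq a one -> text e' v = nseq d one ->
  text (rat_printer s e e') v = rat_word s a d.
Proof. by rewrite /rat_word /= => -> ->; case: s. Qed.

Lemma text_interval e e' v u u' : text e v = u -> text e' v = u' ->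
  items (interval_printer e e') v = [:: enclose (pairing (u : Y S Words) u')].
Proof. by move=> <- <-; rewrite -[items _ _]/[:: text (Enclose (Cat (Enclose e) (Enclose e'))) v] text_Enclose text_Cat !text_Enclose. Qed.

Lemma items_Cat (e1 e2 : @printer S) v : items (Cat e1 e2) v = items e1 v ++ items e2 v.
Proof. by []. Qed.

Lemma mem_items_For (w : word S) l e v :
  w \in items (For l e) v <-> exists2 i, i < nth 0 v l & w \in items e (i :: v).
Proof.
split=> [/flattenP[s /mapP[i]]|[i lt wi]].
  by rewrite mem_iota add0n => lt -> wi; exists i.
apply/flattenP; exists (items e (i :: v)) => //.
by apply/mapP; exists i; rewrite ?mem_iota.
Qed.

Lemma items_intervals (a d c e : nat) v (b : bool) :
  items (intervals_printer b) [:: e, c, d, a & v] =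
  let upper := rat_word false (c + e.+2) c in
  if b then [:: enclose (pairing (rat_word true a d : Y S Words) upper);
                enclose (pairing (rat_word false a (a + d) : Y S Words) upper)]
  else [:: enclose (pairing (rat_word true a.+1 d : Y S Words) (rat_word false c.+1 e))].
Proof.
set v' := [:: e, c, d, a & v].
have t0 : text (ones_printer 0) v' = nseq e one by rewrite text_ones.
have t1 : text (ones_printer 1) v' = nseq c one by rewrite text_ones.
have t2 : text (ones_printer 2) v' = nseq d one by rewrite text_ones.
have t3 : text (ones_printer 3) v' = nseq a one by rewrite text_ones.
case: b; rewrite /intervals_printer.
  have up : text (rat_printer false (Cat (ones_printer 1)
      (Cat (Lit [:: one; one]) (ones_printer 0))) (ones_printer 1)) v' =
      rat_word false (c + e.+2) c.
    by apply: text_rat => //; rewrite !text_Cat t1 t0 nseqD.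
  have iv s e' a' d' : text (rat_printer s (ones_printer 3) e') v' = rat_word s a' d' ->
      items (interval_printer (rat_printer s (ones_printer 3) e') _) v' = _ :=
    fun E => text_interval E up.
  rewrite items_Cat (iv true _ a d) ?(iv false _ a (a + d)) //; apply: text_rat => //.
  by rewrite text_Cat t3 t2 nseqD.
by rewrite (@text_interval _ _ _ (rat_word true a.+1 d) (rat_word false c.+1 e)) //;
  apply: text_rat; rewrite ?text_Cat ?t3 ?t1.
Qed.

Lemma mem_value_items b N w : w \in value_items b N <-> exists2 K, K < N & w = [:: one] \/
  exists a d c e, [/\ a < K, d < K, c < K, e < K &
    w \in items (intervals_printer b) [:: e; c; d; a; K; N]].
Proof.
rewrite /value_items mem_items_For; split=> [[K lt]|[K lt H]].
  rewrite items_Cat inE => /orP[/eqP ->|]; first by exists K => //; left.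
  move=> /mem_items_For[a la] /mem_items_For[d ld] /mem_items_For[c lc] /mem_items_For[e le] H.
  by exists K => //; right; exists a, d, c, e.
exists K => //; rewrite items_Cat inE; case: H => [->|[a [d [c [e [la ld lc le H]]]]]].
  by rewrite eqxx.
apply/orP; right; apply/mem_items_For; exists a => //; apply/mem_items_For; exists d => //.
by apply/mem_items_For; exists c => //; apply/mem_items_For; exists e.
Qed.

Lemma value_itemsE b N : value_items b N = flatten (mkseq (fun K =>
  [:: one] :: items (For 0 (For 1 (For 2 (For 3 (intervals_printer b))))) [:: K]) N).
Proof. by rewrite /value_items; case: b. Qed.

Lemma value_items_prefix b N : prefix (value_items b N) (value_items b N.+1).
Proof. by rewrite !value_itemsE mkseqS flatten_rcons prefix_prefix. Qed.

Lemma size_value_items b N : N <= size (value_items b N).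
Proof.
rewrite value_itemsE; elim: N => // N IH.
by rewrite mkseqS flatten_rcons size_cat /= addnS ltnS (leq_trans IH) // leq_addr.
Qed.

Lemma size_flatten_ge (s : seq (word S)) : all (fun w => 0 < size w) s ->
  size s <= size (flatten s).
Proof.
by elim: s => //= w s IH /andP[w0 /IH le]; rewrite size_cat -add1n leq_add.
Qed.

Lemma value_items_ok b N w : w \in value_items b N ->
  w = [:: one] \/ exists2 u, unit_intervals b u & w = enclose u.
Proof.
move=> /mem_value_items[K _ [->|[a [d [c [e [_ _ _ _]]]]]]]; first by left.
rewrite items_intervals; case: b => H; right.
  pose u1 : word S := pairing (rat_word true a d : Y S Words) (rat_word false (c + e.+2) c).
  pose u2 : word S := pairing (rat_word false a (a + d) : Y S Words) (rat_word false (c + e.+2) c).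
  have {}H : w \in [:: enclose u1; enclose u2] := H.
  move: H; rewrite !inE => /orP[]/eqP ->; [exists u1|exists u2] => //.
    exists true, a, d, false, (c + e.+2), c; split=> //.
    by rewrite /below_one /above_one /= !addnS !ltnS leq_addr.
  exists false, a, (a + d), false, (c + e.+2), c; split=> //.
  by rewrite /below_one /above_one /= !addnS !ltnS !leq_addr.
pose u1 : word S := pairing (rat_word true a.+1 d : Y S Words) (rat_word false c.+1 e).
have {}H : w \in [:: enclose u1] := H.
move: H; rewrite inE => /eqP ->; exists u1 => //.
by exists true, a.+1, d, false, c.+1, e.
Qed.

Lemma value_items_all b u : unit_intervals b u -> exists N, enclose u \in value_items b N.
Proof.
move=> [s [a [d [s' [a' [d' [-> H]]]]]]].
suff [x [y [z [t Hm]]]] : exists x y z t, forall v,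
    enclose (pairing (rat_word s a d : Y S Words) (rat_word s' a' d')) \in
    items (intervals_printer b) [:: t, z, y, x & v].
  pose K := (maxn (maxn x y) (maxn z t)).+1; exists K.+1; apply/mem_value_items.
  exists K => //; right; exists x, y, z, t.
  have := leqnn K.-1; rewrite {1}/K /= !geq_max => /andP[/andP[? ?] /andP[? ?]].
  by split=> //; exact: Hm.
case: b H => /andP[].
  move=> lo /andP[/negbTE -> gt].
  have [s1 E] : exists e, a' = d' + e.+2.
    by exists (a' - d'.+2); rewrite -{1}(subnKC gt) !addnS addSn.
  rewrite E; case: s lo => [_|le].
    by exists a, d, d', s1 => v; rewrite items_intervals; apply: mem_head.
  exists a, (d - a), d', s1 => v; rewrite items_intervals subnKC //.
  by apply: mem_behead; apply: mem_head.
case: s => //; case: a => // a _; case: s' => //; case: a' => // a' _.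
by exists a, d, a', d' => v; rewrite items_intervals; apply: mem_head.
Qed.

Lemma value_limit b : exists r, (forall N, initial (value_prefix b N) r) /\
  lists r (unit_intervals b).
Proof.
have pos N : all (fun w => 0 < size w) (value_items b N).
  by apply/allP => w /value_items_ok[->|[u _ ->]].
have [N|N|r Hr] := @chain_limit _ (value_prefix b).
- by have /prefixP[s E] := value_items_prefix b N; rewrite /value_prefix E flatten_cat prefix_prefix.
- exact: leq_trans (size_value_items b N) (size_flatten_ge (pos N)).
exists r; split=> //; apply: (@lists_chain _ (value_items b)) => //.
- exact: value_items_prefix.
- exact: size_value_items.
- exact: value_items_ok.
- exact: value_items_all.
Qed.

End Intervals.

(** * Points with a second name that may be empty *)

Section Echoes.
Context {S : alphabet}.
Local Notation zero := (a0 S).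
Local Notation one := (a1 S).

Section Space.
Variable c : nat -> bool.

(** The name [2n] of the singleton of [n] has the echo [2n+1], which is a name of
    the empty set unless [c n] holds. *)
Definition echo_set (m : nat) : set nat := [set x | m./2 = x /\ (odd m -> c x)].

Lemma echo_even n : echo_set n.*2 = [set n].
Proof.
apply/seteqP; split=> x; rewrite /echo_set /= doubleK odd_double; first by case.
by move=> ->.
Qed.

Lemma echo_cover x : exists m, echo_set m x.
Proof. by exists x.*2; rewrite echo_even. Qed.

Lemma echo_T0 x y : x <> y ->
  exists m, (echo_set m x /\ ~ echo_set m y) \/ (~ echo_set m x /\ echo_set m y).
Proof. by move=> ne; exists x.*2; left; rewrite echo_even; split=> // /esym. Qed.

Definition echoes : ctspace S := numbered echo_cover echo_T0.

Lemma echoes_D : D echoes.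
Proof. by apply: openD => m x y [<- _] []. Qed.

End Space.

Lemma flatten_nseqD (w : word S) a b :
  flatten (nseq a w) ++ flatten (nseq b w) = flatten (nseq (a + b) w).
Proof. by rewrite nseqD flatten_cat. Qed.

Lemma text_For_Lit l (w : word S) v : text (For l (Lit w)) v = flatten (nseq (nth 0 v l) w).
Proof.
rewrite /=; congr flatten; elim: (nth 0 v l) => // m IH.
by rewrite mkseqS IH -cats1 -addn1 nseqD.
Qed.

Definition front_printer (jx : nat) (e : @printer S) (t : bool) : printer :=
  Cat (ones_printer jx) (Cat (Lit [:: one; one; zero]) (Cat e (Lit (ending t)))).

Definition graph_entry (jx : nat) (e : @printer S) (lx : nat) (b t : bool) : printer :=
  Block (Enclose (Cat (Enclose (front_printer jx e t)) (Enclose (value_printer lx b)))).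

Definition graph_entries jx e lx b : printer := Cat (graph_entry jx e lx b false) (graph_entry jx e lx b true).

Definition pairs (l : nat) : @printer S := For l (Lit [:: one; zero; one; zero]).

Lemma text_pairs l v : text (pairs l) v = flatten (nseq (nth 0 v l).*2 [:: one; zero]).
Proof.
rewrite text_For_Lit; elim: (nth 0 v l) => // m IH.
by rewrite doubleS /= IH.
Qed.

(** One round of a name of the function that is zero at [n] and one elsewhere;
    the variables are the bound of the round and [n]. The numbers [2i] and [2i+1]
    of an argument [i] are treated by separate loops for [i] below [n], for [n]
    itself and for the numbers from [2n+2] on, so that no comparison is made. *)
Definition graph_printer : printer :=
  let pair := Lit [:: one; zero] in
  Cat (Lit [:: one]) (For 0 (Cat
    (For 2 (Cat (graph_entries 1 (pairs 0) 2 true) (graph_entries 1 (Cat (pairs 0) pair) 2 true)))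
    (Cat
      (Cat (graph_entries 0 (pairs 2) 1 false) (graph_entries 0 (Cat (pairs 2) pair) 1 false))
      (For 1 (graph_entries 1 (Cat (pairs 3) (Cat pair (Cat pair (For 0 pair)))) 2 true))))).

Definition graph_word (n N j m : nat) (t : bool) : word S :=
  pairing (front j m t : Y S Words) (value_prefix (m./2 != n) N).

Lemma mem_graph_entries w jx e lx b v m : text e v = flatten (nseq m [:: one; zero]) ->
  w \in items (graph_entries jx e lx b) v <-> exists t, w =
    enclose (pairing (front (nth 0 v jx) m t : Y S Words) (value_prefix b (nth 0 v lx))).
Proof.
move=> E.
have item t : items (graph_entry jx e lx b t) v =
    [:: enclose (pairing (front (nth 0 v jx) m t : Y S Words) (value_prefix b (nth 0 v lx)))].
  apply: (@text_interval _ (front_printer jx e t) (value_printer lx b)).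
    by rewrite /front_printer !text_Cat text_ones E.
  exact: text_value_printer.
rewrite items_Cat mem_cat !item !inE; split=> [/orP[]/eqP ->|[t ->]].
- by exists false.
- by exists true.
- by case: t; rewrite eqxx ?orbT.
Qed.

Let pair : @printer S := Lit [:: one; zero].

Lemma text_odd_pairs l v : text (Cat (pairs l) pair) v =
  flatten (nseq (nth 0 v l).*2.+1 [:: one; zero]).
Proof.
by rewrite text_Cat text_pairs -[text pair v]/(flatten (nseq 1 [:: one; zero])) flatten_nseqD addn1.
Qed.

Lemma text_far_pairs l v : text (Cat (pairs l) (Cat pair (Cat pair (For 0 pair)))) v =
  flatten (nseq ((nth 0 v l).*2 + (nth 0 v 0).+2) [:: one; zero]).
Proof. by rewrite !text_Cat text_pairs text_For_Lit -flatten_nseqD. Qed.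

Lemma graph_items n N w : w \in items graph_printer [:: N; n] ->
  w = [:: one] \/ exists j m t, w = enclose (graph_word n N j m t).
Proof.
rewrite items_Cat inE => /orP[/eqP ->|]; first by left.
move=> /mem_items_For[j _] H; right; exists j.
move: H; rewrite items_Cat mem_cat => /orP[|].
  move=> /mem_items_For[i lti]; have {}lti : i < n := lti.
  rewrite items_Cat mem_cat => /orP[].
    move=> /(mem_graph_entries _ _ _ _ (text_pairs _ _))[t ->]; exists i.*2, t.
    by rewrite /graph_word doubleK ltn_eqF.
  move=> /(mem_graph_entries _ _ _ _ (text_odd_pairs _ _))[t ->]; exists i.*2.+1, t.
  by rewrite /graph_word /= uphalf_double ltn_eqF.
rewrite items_Cat mem_cat => /orP[|].
  rewrite items_Cat mem_cat => /orP[].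
    move=> /(mem_graph_entries _ _ _ _ (text_pairs _ _))[t ->]; exists n.*2, t.
    by rewrite /graph_word doubleK eqxx.
  move=> /(mem_graph_entries _ _ _ _ (text_odd_pairs _ _))[t ->]; exists n.*2.+1, t.
  by rewrite /graph_word /= uphalf_double eqxx.
move=> /mem_items_For[d _] /(mem_graph_entries _ _ _ _ (text_far_pairs _ _))[t ->].
exists (n.*2 + d.+2), t; rewrite /graph_word halfD odd_double /= doubleK gtn_eqF //.
by rewrite add0n addnS ltnS leq_addr.
Qed.

Lemma mem_graph_items n N j m t : j < N -> m < N ->
  enclose (graph_word n N j m t) \in items graph_printer [:: N; n].
Proof.
move=> ltj ltm; rewrite items_Cat inE; apply/orP; right.
apply/mem_items_For; exists j => //; rewrite items_Cat mem_cat /graph_word.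
have mE := odd_double_half m; case: (ltngtP m./2 n) => [lt|lt|E].
- apply/orP; left; apply/mem_items_For; exists m./2 => //.
  rewrite items_Cat mem_cat; apply/orP; case: (odd m) mE => mE; [right|left].
    by apply/(mem_graph_entries _ _ _ _ (text_odd_pairs _ _)); exists t; rewrite -{1}mE.
  by apply/(mem_graph_entries _ _ _ _ (text_pairs _ _)); exists t; rewrite -{1}mE.
- apply/orP; right; rewrite items_Cat mem_cat; apply/orP; right.
  have le : n.*2.+2 <= m by rewrite -mE -doubleS (leq_trans _ (leq_addl _ _)) // leq_double.
  apply/mem_items_For; exists (m - n.*2.+2); first by rewrite (leq_ltn_trans (leq_subr _ _)).
  apply/(mem_graph_entries _ _ _ _ (text_far_pairs _ _)); exists t.
  by rewrite -{1}(subnKC le) !addSnnS.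
- apply/orP; right; rewrite items_Cat mem_cat; apply/orP; left.
  rewrite items_Cat mem_cat; apply/orP; case: (odd m) mE => mE; [right|left].
    by apply/(mem_graph_entries _ _ _ _ (text_odd_pairs _ _)); exists t; rewrite -{1}mE E.
  by apply/(mem_graph_entries _ _ _ _ (text_pairs _ _)); exists t; rewrite -{1}mE E.
Qed.

Let round (n N : nat) : word S := text graph_printer [:: N; n].

Lemma graph_limit n : exists p, (forall N, initial (flatten (mkseq (round n) N)) p) /\
  lists p [set u | exists N, enclose u \in items graph_printer [:: N; n]].
Proof.
pose L N := flatten (mkseq (fun N => items graph_printer [:: N; n]) N).
have EL N : flatten (mkseq (round n) N) = flatten (L N).
  rewrite /L; elim: N => // N IH.
  by rewrite !mkseqS !flatten_rcons IH flatten_cat flatten_items.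
have LS N : prefix (L N) (L N.+1) by rewrite /L mkseqS flatten_rcons prefix_prefix.
have Lsize N : N <= size (L N).
  rewrite /L; elim: N => // N IH; rewrite mkseqS flatten_rcons size_cat -addn1 leq_add //.
have L_in N c : c \in L N -> exists N', c \in items graph_printer [:: N'; n].
  by move=> /flattenP[s /mapP[N' _ ->]]; exists N'.
have pos N : all (fun w => 0 < size w) (L N).
  apply/allP => w /L_in[N' /graph_items[->|[j [m [t ->]]]]] //.
have [N|N|p Hp] := @chain_limit _ (fun N => flatten (L N)).
- by have /prefixP[s ->] := LS N; rewrite flatten_cat prefix_prefix.
- exact: leq_trans (Lsize N) (size_flatten_ge (pos N)).
exists p; split; first by move=> N; rewrite EL.
apply: (@lists_chain _ L) => //.
  move=> N c /L_in[N' cN']; have [|[j [m [t E]]]] := graph_items cN'; first by left.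
  by right; exists (graph_word n N' j m t) => //; exists N'; rewrite -E.
move=> u [N uN]; exists N.+1; rewrite /L mkseqS flatten_rcons mem_cat; apply/orP; right.
exact: uN.
Qed.

(** Only the pairs in the graph that are about the number with which the name
    of the argument begins apply to this argument. *)
Lemma graph_eta n p r (q : sequence S) j m t :
  lists p [set u | exists N, enclose u \in items graph_printer [:: N; n]] ->
  (forall N, initial (value_prefix (m./2 != n) N) r) ->
  initial (front j m t) q -> eta p q r.
Proof.
move=> pL Hr Hq; pose applies v := exists l, occurs (pairing (mkseq q l : Y S Words) v) p.
have value_ge N : N <= size (value_prefix (S := S) (m./2 != n) N).
  apply: leq_trans (size_value_items (m./2 != n) N) (size_flatten_ge _).
  by apply/allP => w /value_items_ok[->|[u _ ->]].
split=> [v [l /(occurs_lists _ pL)[N /graph_items[|[j' [m' [t' /enclose_inj]]]]]]|M].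
- by rewrite encloseE.
- move=> /pairing_inj[ql ->]; have Hq' : initial (front j' m' t') q.
    by rewrite -ql; exact: initial_mkseq.
  by rewrite (front_uniq Hq' Hq).
pose N := (maxn (maxn j m) M).+1.
exists (value_prefix (m./2 != n) N); last first.
  by apply: leq_trans (value_ge N); rewrite leqW // leq_maxr.
exists (size (@front S j m t)); apply/(occurs_lists _ pL); exists N.
have -> : mkseq q (size (@front S j m t)) = front j m t by [].
by apply: mem_graph_items; rewrite ltnS leq_max leq_max leqnn ?orbT.
Qed.

Let ctr (m : nat) : 'I_21 := inord m.
Let i0 : 'I_2 := ord0.

Definition halve (a b : 'I_21) : @prog S 2 21 :=
  until0 a (seqp (basic (Dec a)) (cond (fun _ z => ~~ z a)
    (seqp (basic (Dec a)) (basic (Inc b))) stop)).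

Lemma exec_halve x (a b : 'I_21) s : a != b ->
  exec x (halve a b) s [::] (setc (setc s a 0) b (ct s b + (ct s a)./2)).
Proof.
move=> ab; have [M] := ubnP (ct s a); elim: M s => // M IH s; rewrite ltnS => leM.
case Ea : (ct s a) => [|[|m]].
- rewrite addn0 setc_id; last by rewrite setc_id.
  by rewrite [setc s a 0]setc_id //; apply: exec_while0; rewrite /holds /zeros Ea.
- rewrite addn0 [setc _ b _]setc_id; last by rewrite /= eq_sym (negbTE ab).
  rewrite -[[::]]/(([::] ++ [::]) ++ [::]).
  apply: (@exec_whileS _ _ _ x _ _ _ _ (setc s a 0)).
  + by rewrite /holds /zeros Ea.
  + apply: exec_seq; first exact: exec_basic.
    rewrite /= Ea; apply: exec_cond; rewrite /holds /zeros /= eqxx /=.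
    exact: exec_stop.
  + by apply: exec_while0; rewrite /holds /zeros /= eqxx.
pose s' := setc (setc s a m) b (ct s b).+1.
have s'a : ct s' a = m by rewrite /= (negbTE ab) eqxx.
have s'b : ct s' b = (ct s b).+1 by rewrite /= eqxx.
rewrite -[[::]]/(([::] ++ ([::] ++ [::])) ++ [::]).
apply: (@exec_whileS _ _ _ x _ _ _ _ s').
- by rewrite /holds /zeros Ea.
- apply: exec_seq; first exact: exec_basic.
  apply: exec_cond; rewrite /holds /zeros /= eqxx Ea /=.
  rewrite -[[::]]/([::] ++ [::]); apply: exec_seq; first exact: exec_basic.
  rewrite /= eqxx setc_setc /=.
  suff -> : s' = do_op (Inc b : @op S 2 21) (setc s a m) by exact: exec_basic.
  by rewrite /= eq_sym (negbTE ab).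
suff <- : setc (setc s' a 0) b (ct s' b + (ct s' a)./2) =
    setc (setc s a 0) b (ct s b + m.+2./2).
  by apply: IH; rewrite s'a; apply: leq_trans leM; rewrite Ea ltnW.
rewrite s'a s'b addSnnS; apply: storeP => // l /=.
by do !case: eqP.
Qed.

Let fresh : seq 'I_21 := [seq ctr l | l <- iota 5 16].

Definition graph_start : @prog S 2 21 :=
  seqp (read_number i0 (ctr 0) (ctr 1)) (halve (ctr 0) (ctr 2)).

Definition graph_round : @prog S 2 21 :=
  seqp (print (ctr 4) [:: ctr 3; ctr 2] fresh graph_printer) (basic (Inc (ctr 3))).

Lemma result_graph (q1 q2 p : sequence S) j m t :
  initial (front j m t) q1 ->
  (forall N, initial (flatten (mkseq (round m./2) N)) p) ->
  result (compile (seqp graph_start (forever graph_round)))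
    (tnth [tuple tape_of (q1 : Y S Sequences); tape_of (q2 : Y S Sequences)])
    (p : Y S Sequences).
Proof.
move=> Hq Hp; set x := tnth _.
have x0 l : x i0 l = Some (q1 l) by rewrite /x (tnth_nth (tape_of (q1 : Y S Sequences))).
have ctrE l l' : l < 21 -> l' < 21 -> (ctr l == ctr l') = (l == l').
  by move=> lt lt'; rewrite -val_eqE /= !inordK.
have [||||h E0] := exec_read_number x0 (s := store0) (c := ctr 0) (f := ctr 1) _ _ _ _ Hq;
  rewrite ?ctrE //.
pose s1 := setc (seth store0 i0 h) (ctr 0) m.
pose s2 := setc (setc s1 (ctr 0) 0) (ctr 2) m./2.
have E1 : exec x (halve (ctr 0) (ctr 2)) s1 [::] s2.
  have := exec_halve x s1 (a := ctr 0) (b := ctr 2).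
  by rewrite /s1 /= eqxx !ctrE //= => /(_ isT).
pose st N := setc s2 (ctr 3) N.
apply: (@result_forever _ _ _ x graph_start graph_round [::] st (round m./2)) => //.
- rewrite /st setc_id; last by rewrite /s2 /= !ctrE.
  by rewrite -[[::]]/([::] ++ [::]); apply: exec_seq E0 E1.
move=> N; rewrite -[round _ _]cats0.
have E : [seq ct (st N) l | l <- [:: ctr 3; ctr 2]] = [:: N; m./2].
  by rewrite /st /s2 /= !ctrE.
rewrite /round -E; apply: (exec_seq (s' := st N)).
  apply: exec_print => //.
  - rewrite -[_ :: _]/([seq ctr l | l <- [:: 4, 3, 2 & iota 5 16]]).
    rewrite map_inj_in_uniq // => l l' ll ll' /eqP.
    have /allP lt21 : all (fun l => l < 21) [:: 4, 3, 2 & iota 5 16] by [].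
    by rewrite ctrE ?lt21 // => /eqP.
  - by rewrite /st /s2 /= !ctrE.
  - move=> l /mapP[l' + ->]; rewrite mem_iota => /andP[le lt].
    by rewrite /st /s2 /= !ctrE // ?gtn_eqF // (leq_trans _ le).
suff -> : st N.+1 = do_op (Inc (ctr 3) : @op S 2 21) (st N) by exact: exec_basic.
by rewrite /= eqxx setc_setc.
Qed.

(** The function is one at all points but the given one, in particular on every
    closed set that omits it. *)
Lemma echoes_CTy (R : realType) c : CTy (echoes c) R.
Proof.
apply: (multi_computable_result (M := compile (seqp graph_start (forever graph_round)))).
move=> q1 q2 x A /delta_front[j [m [t [Hq [mx _]]]]] _ [_ [_ _ xA _ _]].
have [p [Hp pL]] := graph_limit m./2; exists p; first exact: result_graph Hq Hp.
pose f (y : echoes c) : R := (((y : nat) != x)%:R)%R.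
have f_cont : continuous f.
  move=> y B /nbhs_singleton fyB; apply/nbhsP; exists (nseq (y : nat).*2 one).
  rewrite /= of_pieces_ones echo_even; split=> // z /= zy.
  by rewrite /= zy.
exists f; split=> //.
- move=> q y /delta_front[j' [m' [t' [Hq' [m'y _]]]]].
  have [r [Hr rL]] := @value_limit S (m'./2 != m./2).
  exists r; first exact: graph_eta pL Hr Hq'.
  by rewrite /rho /f -m'y -mx unit_intervalsE.
- by move=> _ [y _ <-]; rewrite /= in_itv /= /f; case: (_ != _); rewrite ?ler01 ?lexx.
- by rewrite /f eqxx.
- by move=> _ [y Ay <-] /=; rewrite /f; case: eqVneq => [yx|//]; case: xA; rewrite -yx.
Qed.

(** For each [n], the second name of [n] is made empty or not so that the
    [n]-th pair of an enumeration of machines fails. If the machines offer a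
    neighbourhood of [n] inside the set with this name, either it is a
    neighbourhood of [n] in any case, and the set is made empty, or it is one if
    the set is not. Then the closed set between them is refuted: if its
    complement visibly contains [n], by making the set nonempty, and by making
    it empty otherwise. *)
Lemma echoes_notSCT3 : exists c, ~ SCT3 (echoes c).
Proof.
have [g Hg] := @machine_enumeration S 2.
pose machines n : nat * nat := if unpickle n is Some e then e else (0, 0).
pose second n : word S := nseq n.*2.+1 one.
pose sure n (u : word S) := binary u /\ {in pieces u, forall m, m = n.*2}.
pose likely n (u : word S) := binary u /\ {in pieces u, forall m, m./2 = n}.
pose Q n u w := exists z : Y S Words,
  result (g (machines n).1) (fun i => tape_of (tnth [tuple u; w] i : Y S Words)) z.
pose answers n (u w : word S) (p : sequence S) := result (g (machines n).2)
  (tnth [tuple tape_of (u : Y S Words); tape_of (w : Y S Words)]) (p : Y S Sequences).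
pose too_big n := exists u, sure n u /\ Q n u (second n).
pose offered n := exists u, likely n u /\ Q n u (second n).
pose refuted n := exists u, [/\ likely n u, Q n u (second n) &
  exists p, answers n u (second n) p /\ exists2 v, sure n v & occurs v p].
pose c n := `[< ~ too_big n /\ (offered n -> refuted n) >].
exists c => -[Q' [r [[M1 HM1] [M2 HM2] _ cover between]]].
have [e1 He1] := Hg M1; have [e2 He2] := Hg M2; pose n := pickle (e1, e2).
have nE : machines n = (e1, e2) by rewrite /machines pickleK.
have QE u w : Q' [tuple u; w] <-> Q n u w.
  by rewrite HM1 /Q nE; split=> -[z /He1 Hz]; exists z.
have rE u w p : r u w = Some p <-> answers n u w p.
  by rewrite HM2 /answers nE He2.
have secondE : base_set (@nu S (echoes c)) (second n) = [set x : nat | x = n /\ c n].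
  rewrite /base_set /= of_pieces_ones /echo_set; apply/seteqP; split=> x /=.
    by rewrite uphalf_double odd_double /= => -[<- /(_ isT)].
  by rewrite uphalf_double odd_double /= => -[-> cn].
have sureE u : sure n u -> base_set (@nu S (echoes c)) u n.
  by move=> [bu Hu]; split=> // m /Hu ->; rewrite echo_even.
have likelyE u : likely n u -> c n -> base_set (@nu S (echoes c)) u n.
  by move=> [bu Hu] cn; split=> // m /Hu mn.
have in_likely u : base_set (@nu S (echoes c)) u n -> likely n u.
  by move=> [bu Hu]; split=> // m /Hu[].
have in_sure u : base_set (@nu S (echoes c)) u n -> ~~ c n -> sure n u.
  move=> [bu Hu] /negP cn; split=> // m /Hu[mn om].
  by rewrite -mn -[LHS]odd_double_half; case: (odd m) om => // /(_ isT).
have [cn|/negP cn] := pselect (c n).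
  have /asboolP[_ off] := cn.
  have : base_set (@nu S (echoes c)) (second n) n by rewrite secondE.
  rewrite cover // => -[u /QE Qu /in_likely lu].
  have [|u' [lu' Qu' [p [outp [v sv vp]]]]] := off; first by exists u.
  have /QE/between[p' [A [/rE outp' [_ AE] uA _]]] := Qu'.
  have An := uA _ (likelyE _ lu' cn).
  have : (~` A) n.
    rewrite AE; exists v; last exact: sureE.
    by rewrite /mkset (result_unique (kd := Sequences) outp' outp).
  by [].
have second0 : ~ base_set (@nu S (echoes c)) (second n) n.
  by rewrite secondE => -[_]; exact: negP.
have [[u [su Qu]]|nbig] := pselect (too_big n).
  have /QE/between[p [A [_ _ uA Aw]]] := Qu.
  by apply: second0; apply: Aw; apply: uA; apply: sureE.
have [[u [lu Qu]]|noff] := pselect (offered n); last first.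
  by case/negP: cn; apply/asboolP; split.
have /QE/between[p [A [/rE outp [_ AE] _ Aw]]] := Qu.
have : (~` A) n by move=> /Aw/second0.
rewrite AE => -[v vp /in_sure/(_ cn) sv].
case/negP: cn; apply/asboolP; split=> // _.
by exists u; split=> //; exists p; split=> //; exists v.
Qed.

End Echoes.

(** * The counterexamples *)

Theorem theorem5p5 (S : alphabet) (R : realType) :
  [/\ exists X : ctspace S, CT2 X /\ D X /\ ~ SCT2 X,
      exists X : ctspace S, CT0 X /\ CT4 X /\ ~ T1 X,
      exists X : ctspace S, SCT2 X /\ ~ T3 X,
      exists X : ctspace S, SCT2 X /\ T4 X /\ ~ WCT3 X
    & exists X : ctspace S, CTy X R /\ D X /\ ~ SCT3 X].
Proof.
split.
- have [c Hc] := @twins_notSCT2 S.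
  by exists (twins c); split; [exact: twins_CT2|split=> //; exact: twins_D].
- by exists sierpinski; split; [exact: sierpinski_CT0|split; [exact: sierpinski_CT4|exact: sierpinski_notT1]].
- by exists (comb (fun n => n) (fun=> setT)); split; [exact: comb_SCT2|exact: comb_notT3].
- have [K HK] := @comb_notWCT3 S.
  by exists (comb K (fun e => [set e])); split; [exact: comb_SCT2|split=> //; exact: comb_T4].
- have [c Hc] := @echoes_notSCT3 S.
  by exists (echoes c); split; [exact: echoes_CTy|split=> //; exact: echoes_D].
Qed.
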